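(* Suppose that $\Omega=\operatorname{int}\big(\mathcal D_1\setminus(\mathcal O\cup\mathcal L)\big)$ is a bounded set with Lipschitz boundary. Then there exists one and only one minimizer $f^*\in\mathcal R$ of the conformal energy $E^C$ over the feasible region $\mathcal R$.
   Context: Let $a,b,w>0$, $\mathcal D_1=[0,a]\times[0,b]$, $\mathcal D_2=[0,wa]\times[0,b]$. Let $\mathcal O_1,\dots,\mathcal O_K\subseteq\mathcal D_1$ (regions of interest) and $\mathcal L_1,\dots,\mathcal L_J\subseteq\mathcal D_1$ (line structures) be such that $\mathcal O_1,\dots,\mathcal O_K,\mathcal L_1,\dots,\mathcal L_J,\partial\mathcal D_1$ are disjoint sets. Put $\mathcal O=\bigcup_i\mathcal O_i$, $\mathcal L=\bigcup_j\mathcal L_j$. The following data are given in advance: $r_{\mathcal O}>0$; $2\times2$ diagonal matrices $R_{\mathcal L_j}$ with positive diagonal entries; vectors $\mathbf t_{\mathcal O_i},\mathbf t_{\mathcal L_j}\in\mathbb R^2$, such that $r_{\mathcal O}\mathbf x+\mathbf t_{\mathcal O_i}\in\mathcal D_2$ for $\mathbf x\in\mathcal O_i$ and $R_{\mathcal L_j}\mathbf x+\mathbf t_{\mathcal L_j}\in\mathcal D_2$ for $\mathbf x\in\mathcal L_j$; and a bijective continuous map $g:\partial\mathcal D_1\to\partial\mathcal D_2$ with $g(0,0)=(0,0)$, $g(a,0)=(wa,0)$, $g(0,b)=(0,b)$, $g(a,b)=(wa,b)$. The feasible region $\mathcal R$ is the set of all $\mathbb R^2$-valued $f\in H^1(\mathcal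 D_1)$ with $f|_{\partial\mathcal D_1}(\mathbf x)=g(\mathbf x)$, $f|_{\mathcal O_i}(\mathbf x)=r_{\mathcal O}\mathbf x+\mathbf t_{\mathcal O_i}$ for $i=1,\dots,K$, and $f|_{\mathcal L_j}(\mathbf x)=R_{\mathcal L_j}\mathbf x+\mathbf t_{\mathcal L_j}$ for $j=1,\dots,J$. For $f\in\mathcal R$ the conformal energy is $$E^C(f)=\frac12\int_{\mathcal D_1}\|\nabla f\|^2-\operatorname{Area}(\mathcal D_2),$$ where $\|\cdot\|$ is the Frobenius norm.
   Formalization: The feasible region R is additionally assumed to be nonempty: a bijective continuous g need not be the boundary trace of any H^1 function, in which case R is empty and no minimizer exists. *)

(* Defs.v *)
From HB Require Import structures.
From mathcomp Require Import all_boot all_order all_algebra.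
From mathcomp Require Import all_classical all_reals all_analysis.

Set Implicit Arguments.
Unset Strict Implicit.
Unset Printing Implicit Defensive.

Import Order.TTheory GRing.Theory Num.Theory.
Import numFieldNormedType.Exports.

Local Open Scope classical_set_scope.
Local Open Scope ring_scope.

(* Points and vectors of the plane are pairs; 'I_2 indexes coordinates, so that
   2 x 2 matrices are 'M[R]_2. *)
Definition pt {R : realType} (x1 x2 : R) : R * R := (x1, x2).

Definition coord {R : realType} (i : 'I_2) (x : R * R) : R :=
  if i == ord0 then x.1 else x.2.

Definition basis {R : realType} (i : 'I_2) : R * R :=
  if i == ord0 then pt 1 0 else pt 0 1.

Definition apply_mx {R : realType} (A : 'M[R]_2) (x : R * R) : R * R :=
  pt (\sum_(j < 2) A ord0 j * coord j x) (\sum_(j < 2) A ord_max j * coord j x).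

Definition frobenius {R : realType} (A : 'M[R]_2) : R :=
  Num.sqrt (\sum_(i < 2) \sum_(j < 2) A i j ^+ 2).

Definition rectangle {R : realType} (a b : R) : set (R * R) :=
  `[0, a]%classic `*` `[0, b]%classic.

Definition boundary {T : topologicalType} (A : set T) : set T :=
  closure A `\` A°.

(* Near every boundary point, and in suitably rotated coordinates
   (c * z.1 + s * z.2, c * z.2 - s * z.1), the set is the region strictly above
   the graph of a Lipschitz function. *)
Definition lipschitz_boundary {R : realType} (Omega : set (R * R)) : Prop :=
  forall p : R * R, boundary Omega p ->
    exists (c s k : R) (gamma : R -> R),
      [/\ c ^+ 2 + s ^+ 2 = 1,
          forall t u : R, `|gamma t - gamma u| <= k * `|t - u| &
          \forall z \near p,
            Omega z <-> gamma (c * z.1 + s * z.2) < c * z.2 - s * z.1].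

Definition area {R : realType} :
    {measure set (measurableTypeR R * measurableTypeR R) -> \bar R} :=
  (@lebesgue_measure R \x @lebesgue_measure R)%E.

Definition L2 {R : realType} (D : set (R * R)) (u : R * R -> R) : Prop :=
  measurable_fun D u /\ area.-integrable D (fun z => (u z ^+ 2)%:E).

(* C^1 on the whole plane; restricting such functions to a closed rectangle
   gives all the functions that are C^1 up to the boundary. *)
Definition C1 {R : realType} (u : R * R -> R) : Prop :=
  (forall z : R * R, differentiable u z) /\
  (forall v : R * R, continuous (fun z : R * R => 'D_v u z)).

(* Test functions of class C^1_c define the same weak derivatives as those of
   class C^oo_c, since C^1_c functions are C^1 limits of their mollifications. *)
Definition test_function {R : realType} (U : set (R * R)) (phi : R * R -> R) :
    Prop :=
  C1 phi /\ exists C : set (R * R),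
    [/\ compact C, C `<=` U & forall z, ~ C z -> phi z = 0].

(* p is an L^2 weak i-th partial derivative of u in the interior of D. *)
Definition weak_partial {R : realType} (D : set (R * R)) (i : 'I_2)
    (u p : R * R -> R) : Prop :=
  L2 D p /\
  forall phi : R * R -> R, test_function D° phi ->
    \int[area]_(z in D) (u z * 'D_(basis i) phi z) =
    - \int[area]_(z in D) (p z * phi z).

Definition H1 {R : realType} (D : set (R * R)) (u : R * R -> R) : Prop :=
  L2 D u /\ forall i : 'I_2, exists p, weak_partial D i u p.

(* A choice of the weak partial derivative, which is unique almost everywhere;
   the default 0 is only used when there is none. *)
Definition wpartial {R : realType} (D : set (R * R)) (i : 'I_2)
    (u : R * R -> R) : R * R -> R :=
  xget (fun=> 0) [set p | weak_partial D i u p].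

Definition H1norm {R : realType} (D : set (R * R)) (u : R * R -> R) : R :=
  Num.sqrt (\int[area]_(z in D) (u z ^+ 2) +
            \sum_(i < 2) \int[area]_(z in D) (wpartial D i u z ^+ 2)).

(* Negligible for the one-dimensional Hausdorff measure. The balls of R * R are
   squares of side 2 r, which leaves the null sets unchanged. On a curve, null
   means of zero arc length. *)
Definition hausdorff1_null {R : realType} (N : set (R * R)) : Prop :=
  forall e : R, 0 < e ->
    exists (c : nat -> R * R) (r : nat -> R),
      [/\ forall k, 0 <= r k,
          N `<=` \bigcup_k ball (c k) (r k) &
          (\sum_(0 <= k <oo) (r k)%:E <= e%:E)%E].

(* u|_S = h for u in H^1(D) and S a subset of D, where S may be Lebesgue-null.
   This is the trace, i.e. the extension by density of the restriction map
   u |-> u|_S of functions that are C^1 up to the boundary of D. Pointwise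
   convergence off an H^1-Hausdorff-null set gives one notion for regions, lines
   and the boundary of D: for a bounded Lipschitz D the limit does not depend on
   the approximating sequence up to such a null set. On the boundary of D it is
   the usual L^2 trace, on an open S it is equality almost everywhere. *)
Definition has_trace {R : realType} (D : set (R * R)) (u : R * R -> R)
    (S : set (R * R)) (h : R * R -> R) : Prop :=
  exists v : nat -> R * R -> R,
    [/\ forall n, C1 (v n),
        (fun n => H1norm D (v n \- u)) @ \oo --> (0 : R) &
        exists N : set (R * R), hausdorff1_null N /\
          forall x, S x -> ~ N x -> (fun n => v n x) @ \oo --> h x].

Definition H1_vec {R : realType} (D : set (R * R)) (f : R * R -> R * R) : Prop :=
  forall i : 'I_2, H1 D (coord i \o f).

Definition has_trace_vec {R : realType} (D : set (R * R)) (f : R * R -> R * R)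
    (S : set (R * R)) (h : R * R -> R * R) : Prop :=
  forall i : 'I_2, has_trace D (coord i \o f) S (coord i \o h).

Definition jacobian {R : realType} (D : set (R * R)) (f : R * R -> R * R)
    (z : R * R) : 'M[R]_2 :=
  \matrix_(i, j) wpartial D j (coord i \o f) z.

Definition feasible {R : realType} (a b : R) (K J : nat)
    (O : 'I_K -> set (R * R)) (L : 'I_J -> set (R * R))
    (rO : R) (tO : 'I_K -> R * R)
    (RL : 'I_J -> 'M[R]_2) (tL : 'I_J -> R * R) (g : R * R -> R * R) :
    set (R * R -> R * R) :=
  [set f | let D1 := rectangle a b in
    [/\ H1_vec D1 f,
        has_trace_vec D1 f (boundary D1) g,
        forall i, has_trace_vec D1 f (O i) (fun x => rO *: x + tO i) &
        forall j, has_trace_vec D1 f (L j) (fun x => apply_mx (RL j) x + tL j)]].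

Definition conformal_energy {R : realType} (a b w : R) (f : R * R -> R * R) : R :=
  let D1 := rectangle a b in
  let D2 := rectangle (w * a) b in
  2^-1 * \int[area]_(z in D1) (frobenius (jacobian D1 f z) ^+ 2) -
  fine (area D2).

Definition minimizer {R : realType} {T : Type} (F : set T) (E : T -> R) (f : T) :
    Prop :=
  F f /\ forall h, F h -> E f <= E h.

(* Main.v *)
(* The energy is, up to a constant, half the sum of the Dirichlet integrals of the
   two coordinates, and the constraints bear on each coordinate separately, so it
   suffices to minimize the Dirichlet integral of a scalar function [u] subject to
   trace conditions, by the direct method. By the parallelogram law a minimizing
   sequence is Cauchy for the Dirichlet seminorm, and by the Poincare inequality,
   which only uses the trace on the bottom edge, it is Cauchy in H^1; uniqueness
   follows in the same way.

   The limit satisfies the trace conditions because [has_trace] is stable under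
   H^1 limits. This rests on a capacity estimate: for [u] of class C^1 the set
   where [l < `|u|] can be covered by balls whose radii add up to at most
   [C / l ^+ 2] times the squared H^1 norm of [u]. It is obtained by cutting the
   rectangle recursively into quarters. *)
Require Import Defs.
From HB Require Import structures.
From mathcomp Require Import all_boot all_order all_algebra.
From mathcomp Require Import all_classical all_reals all_analysis measurable_realfun.
From mathcomp Require Import ring lra.

Set Implicit Arguments.
Unset Strict Implicit.
Unset Printing Implicit Defensive.

Import Order.TTheory GRing.Theory Num.Theory.
Import numFieldNormedType.Exports.

Local Open Scope classical_set_scope.
Local Open Scope ring_scope.

(** * Calculus on rectangles *)

(* The sigma-algebra carried by [area]. *)
Notation plane R := (measurableTypeR R * measurableTypeR R)%type.

(** The conditions bear on arbitrary sets, possibly of zero area, through pointwise convergence of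
    C^1 approximants off a set negligible for length. Their closedness does not come from the
    continuity of an operator into some L^2 space, and this is the obstacle that shapes the proof.
    The remedy is to pass from [has_trace] to [trace_approx], which for each tolerance asks for a
    single C^1 function, close to [u] in H^1 and close to the prescribed value off a set of small
    one-dimensional content. No sequence occurs in it, so it goes to limits by splitting the
    tolerance. It follows from [has_trace] by the capacity estimate along a fast subsequence, and
    gives it back by a Borel-Cantelli argument.

    A second difficulty is that [wpartial] is a mere choice: each computation with the energy rests
    on the uniqueness almost everywhere of weak derivatives, obtained by testing against C^1
    cut-offs of open rectangles.

    The rate 8^-n recurs in the L^2 arguments because a weight 4^n still leaves the summable 2^-n,
    which gives convergence almost everywhere at the rate 2^-n. *)

Section Measurability.
Context {R : realType}.
Implicit Types (A : set (R * R)) (f : R * R -> R).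

(** The sigma-algebra of [plane R] is the product one, so open sets are not measurable by
    definition; an open set is the countable union of the rational open boxes that it contains. *)
Lemma open_measurable_plane A : open A -> @measurable _ (plane R) A.
Proof.
move=> oA.
pose Q (q : (rat * rat) * (rat * rat)) : set (R * R) :=
  `]ratr q.1.1, ratr q.1.2[%classic `*` `]ratr q.2.1, ratr q.2.2[%classic.
have -> : A = \bigcup_(q in [set q | Q q `<=` A]) Q q.
  apply/seteqP; split=> [[x y] Axy|]; last by move=> z [q /= qA]; exact: qA.
  have /nbhs_ballP[e /= e0 eA] : nbhs (x, y) A by exact: open_nbhs_nbhs.
  have [q1 /andP[q1l q1r]] := @rat_in_itvoo R (x - e) x ltac:(by rewrite ltrBlDr ltrDl).
  have [q2 /andP[q2l q2r]] := @rat_in_itvoo R x (x + e) ltac:(by rewrite ltrDl).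
  have [q3 /andP[q3l q3r]] := @rat_in_itvoo R (y - e) y ltac:(by rewrite ltrBlDr ltrDl).
  have [q4 /andP[q4l q4r]] := @rat_in_itvoo R y (y + e) ltac:(by rewrite ltrDl).
  rewrite !bnd_simp in q1l q1r q2l q2r q3l q3r q4l q4r.
  exists ((q1, q2), (q3, q4)); last by split; rewrite /= in_itv/=; apply/andP.
  move=> [u v] [/=]; rewrite !in_itv/= => /andP[u1 u2] /andP[v1 v2]; apply: eA.
  by split => /=; rewrite /ball/= ltr_norml; apply/andP; split; lra.
rewrite bigcup_mkcond; apply: countable_bigcupT_measurable.
  exact: countableP.
move=> q; case: ifPn => // _.
by apply: measurableX; exact: measurable_itv.
Qed.

Lemma continuous_measurable_plane f (D : set (R * R)) :
  @measurable _ (plane R) D -> continuous f ->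
  @measurable_fun _ _ (plane R) (measurableTypeR R) D f.
Proof.
move=> mD cf; apply: measurable_funS (measurableT) (@subsetT _ _) _.
apply: (@measurability _ _ (plane R) (measurableTypeR R) setT f _
  (RGenOpens.measurableE R)) => _ [_ [a [b ->] <-]].
rewrite setTI; apply: open_measurable_plane.
by move/continuousP : cf; apply; exact: interval_open.
Qed.
End Measurability.

(** Free corners are needed for the subdivision into quarters. [rectangle a b] is convertible to
    [rect 0 a 0 b], so the lemmas below apply to the domain directly. *)
Definition rect {R : realType} (x1 x2 y1 y2 : R) : set (R * R) :=
  `[x1, x2]%classic `*` `[y1, y2]%classic.

Section Rect.
Context {R : realType}.
Implicit Types (x y : R) (F : R * R -> R).

Lemma in_rect x1 x2 y1 y2 x y :
  rect x1 x2 y1 y2 (x, y) <-> [/\ x1 <= x, x <= x2, y1 <= y & y <= y2].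
Proof.
rewrite /rect /= !in_itv/=; split=> [[/andP[? ?] /andP[? ?]]//|[-> -> -> ->//]].
Qed.

Lemma measurable_rect x1 x2 y1 y2 : @measurable _ (plane R) (rect x1 x2 y1 y2).
Proof. by apply: measurableX; exact: measurable_itv. Qed.

Lemma areaX (A B : set (measurableTypeR R)) : measurable A -> measurable B ->
  area (A `*` B) = (lebesgue_measure A * lebesgue_measure B)%E.
Proof.
exact: (@product_measure1E _ _ (measurableTypeR R) (measurableTypeR R) R
  lebesgue_measure lebesgue_measure).
Qed.

Lemma lebesgue_itvcc x1 x2 : x1 <= x2 -> lebesgue_measure `[x1, x2]%classic = (x2 - x1)%:E.
Proof.
rewrite le_eqVlt lebesgue_measure_itv/= lte_fin => /predU1P[->|->//].
by rewrite ltxx subrr.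
Qed.

Lemma area_rect x1 x2 y1 y2 : x1 <= x2 -> y1 <= y2 ->
  area (rect x1 x2 y1 y2) = ((x2 - x1) * (y2 - y1))%:E.
Proof.
move=> x12 y12; rewrite areaX; [|exact: measurable_itv..].
by rewrite !lebesgue_itvcc// EFinM.
Qed.

Lemma area_rect_lty x1 x2 y1 y2 : (area (rect x1 x2 y1 y2) < +oo)%E.
Proof.
rewrite areaX; [|exact: measurable_itv..].
by rewrite !lebesgue_measure_itv/=; do 2 case: ifP => _; rewrite ?mul0e ?mule0// -EFinM ltry.
Qed.

Lemma compact_rect x1 x2 y1 y2 : compact (rect x1 x2 y1 y2).
Proof. by apply: compact_setX; exact: segment_compact. Qed.

Lemma continuous_bounded_rect F x1 x2 y1 y2 : continuous F ->
  exists2 M, 0 <= M & forall z, rect x1 x2 y1 y2 z -> `|F z| <= M.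
Proof.
move=> cF; have := @compact_bounded _ _ (F @` rect x1 x2 y1 y2).
case.
  apply: continuous_compact (@compact_rect x1 x2 y1 y2).
  exact: continuous_subspaceT.
move=> M [_ HM]; exists (`|M| + 1); first by rewrite addr_ge0.
move=> z zr; apply: HM; last by exists z.
by rewrite (le_lt_trans (ler_norm M))// ltrDl.
Qed.

Lemma continuous_integrable_rect F x1 x2 y1 y2 : continuous F ->
  area.-integrable (rect x1 x2 y1 y2) (EFin \o F).
Proof.
move=> cF; apply: measurable_bounded_integrable.
- exact: measurable_rect.
- exact: area_rect_lty.
- by apply: continuous_measurable_plane => //; exact: measurable_rect.
- have [M _ HM] := continuous_bounded_rect x1 x2 y1 y2 cF.
  exists M; split; first exact: num_real.
  by move=> N MN z /HM FM; rewrite /= (le_trans FM)// ltW.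
Qed.
End Rect.

Section Fubini.
Context {R : realType}.
Implicit Types (x y : R) (F : R * R -> R).
Local Notation leb := (@lebesgue_measure R).

Lemma continuous_sectionl F y : continuous F -> continuous (fun x => F (x, y)).
Proof.
move=> cF x; apply: (@continuous_comp _ _ _ (fun x => (x, y)) F); last exact: cF.
by apply: (@cvg_pair _ _ _ (nbhs x) (nbhs x) (nbhs y)) => //=; exact: cvg_cst.
Qed.

Lemma continuous_sectionr F x : continuous F -> continuous (fun y => F (x, y)).
Proof.
move=> cF y; apply: (@continuous_comp _ _ _ (fun y => (x, y)) F); last exact: cF.
by apply: (@cvg_pair _ _ _ (nbhs y) (nbhs x) (nbhs y)) => //=; exact: cvg_cst.
Qed.

Lemma continuous_integrable_itv (f : R -> R) x1 x2 : continuous f ->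
  leb.-integrable `[x1, x2] (EFin \o f).
Proof.
move=> cf; apply: continuous_compact_integrable; first exact: segment_compact.
exact: continuous_subspaceT.
Qed.

Lemma lebesgue_itv_lty x1 x2 : (leb `[x1, x2]%classic < +oo)%E.
Proof. by rewrite lebesgue_measure_itv/=; case: ifP => _; rewrite -?EFinB ltry. Qed.

Lemma integrable_rect_patch F x1 x2 y1 y2 : continuous F ->
  area.-integrable setT (EFin \o (F \_ (rect x1 x2 y1 y2))).
Proof.
move=> cF; rewrite -restrict_EFin -integrable_mkcond; last exact: measurable_rect.
exact: continuous_integrable_rect.
Qed.

(** Extending [F] by zero absorbs the rectangle into the integrand and reduces the claim to Fubini's
    theorem on the whole plane. Integrability of the section integrals is returned as well, because
    choosing a good line by averaging requires it. *)
Lemma fubini_rectl F x1 x2 y1 y2 : continuous F ->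
  leb.-integrable `[x1, x2] (EFin \o (fun x => \int[leb]_(y in `[y1, y2]) F (x, y))) /\
  \int[area]_(z in rect x1 x2 y1 y2) F z =
  \int[leb]_(x in `[x1, x2]) \int[leb]_(y in `[y1, y2]) F (x, y).
Proof.
move=> cF.
have iF := integrable_rect_patch x1 x2 y1 y2 cF.
pose G := fun x => \int[leb]_(y in `[y1, y2]) F (x, y).
have GE : fubini_F leb (EFin \o (F \_ (rect x1 x2 y1 y2))) = EFin \o (G \_ `[x1, x2]).
  apply/funext => x; rewrite /fubini_F /= patchE.
  case: ifPn => xI.
    rewrite /G /Rintegral fineK; last first.
      apply: integrable_fin_num => //.
      by apply: continuous_integrable_itv; exact: continuous_sectionr.
    rewrite [RHS]integral_mkcond; apply: eq_integral => y _.
    rewrite /= !patchE /= /rect in_setX xI /=.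
    by case: ifPn.
  apply: integral0_eq => y _; rewrite patchE /rect in_setX (negbTE xI) //.
have iG : leb.-integrable `[x1, x2] (EFin \o G).
  rewrite integrable_mkcond// restrict_EFin -GE.
  exact: (@integrable_fubini_F _ _ (measurableTypeR R) (measurableTypeR R) R leb leb).
split=> //.
rewrite Rintegral_mkcond /Rintegral.
congr fine; rewrite [RHS]integral_mkcond restrict_EFin.
apply: etrans (esym (@integral12_prod_meas1 _ _ (measurableTypeR R)
  (measurableTypeR R) R leb leb _ iF)) _.
by apply: eq_integral => t _; exact: (congr1 (fun h => h t) GE).
Qed.

Lemma fubini_rectr F x1 x2 y1 y2 : continuous F ->
  leb.-integrable `[y1, y2] (EFin \o (fun y => \int[leb]_(x in `[x1, x2]) F (x, y))) /\
  \int[area]_(z in rect x1 x2 y1 y2) F z =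
  \int[leb]_(y in `[y1, y2]) \int[leb]_(x in `[x1, x2]) F (x, y).
Proof.
move=> cF.
have iF := integrable_rect_patch x1 x2 y1 y2 cF.
pose G := fun y => \int[leb]_(x in `[x1, x2]) F (x, y).
have GE : fubini_G leb (EFin \o (F \_ (rect x1 x2 y1 y2))) = EFin \o (G \_ `[y1, y2]).
  apply/funext => y; rewrite /fubini_G /= patchE.
  case: ifPn => yI.
    rewrite /G /Rintegral fineK; last first.
      apply: integrable_fin_num => //.
      by apply: continuous_integrable_itv; exact: continuous_sectionl.
    rewrite [RHS]integral_mkcond; apply: eq_integral => x _.
    rewrite /= !patchE /= /rect in_setX yI andbT /=.
    by case: ifPn.
  apply: integral0_eq => x _; rewrite patchE /rect in_setX (negbTE yI) andbF//.
(* Measurability is part of Fubini's theorem; integrability follows since the section integrals are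
   bounded by the maximum of [F] times the length of the interval. *)
have iG : leb.-integrable `[y1, y2] (EFin \o G).
  apply: measurable_bounded_integrable => //.
  - exact: lebesgue_itv_lty.
  - apply/measurable_EFinP; apply/measurable_restrictT => //.
    rewrite -/(EFin \o G) restrict_EFin -GE.
    exact: (@measurable_fubini_G _ _ (measurableTypeR R) (measurableTypeR R) R leb leb).
  - have [M M0 HM] := continuous_bounded_rect x1 x2 y1 y2 cF.
    exists (M * fine (leb `[x1, x2]%classic)); split; first exact: num_real.
    move=> N MN y yJ; rewrite /= (le_trans _ (ltW MN))//.
    have iFy := continuous_integrable_itv x1 x2 (@continuous_sectionl F y cF).
    rewrite (le_trans (le_normr_Rintegral _ iFy))// -Rintegral_cst//.
    apply: le_Rintegral => //; first exact: integrable_norm.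
      by apply: continuous_integrable_itv; exact: cst_continuous.
    by move=> x xI; apply: HM; split.
split=> //.
rewrite Rintegral_mkcond /Rintegral.
congr fine; rewrite [RHS]integral_mkcond restrict_EFin.
apply: etrans (esym (@integral21_prod_meas1 _ _ (measurableTypeR R)
  (measurableTypeR R) R leb leb _ iF)) _.
by apply: eq_integral => t _; exact: (congr1 (fun h => h t) GE).
Qed.
End Fubini.

Section FTC.
Context {R : realType}.
Local Notation leb := (@lebesgue_measure R).

Lemma continuous_FTC (f f' : R -> R) x1 x2 : continuous f' ->
  (forall t, is_derive t (1 : R) f (f' t)) -> x1 <= x2 ->
  \int[leb]_(t in `[x1, x2]) f' t = f x2 - f x1.
Proof.
move=> cf' df; rewrite le_eqVlt => /predU1P[->|x12].
  by rewrite set_itv1 Rintegral_set1 subrr.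
have cf : continuous f.
  move=> t; apply: differentiable_continuous; apply/derivable1_diffP.
  by have [] := df t.
rewrite /Rintegral (@continuous_FTC2 _ f' f)//.
- exact: continuous_subspaceT.
- split.
  + by move=> t _; have [] := df t.
  + by apply: cvg_at_right_filter; exact: cf.
  + by apply: cvg_at_left_filter; exact: cf.
- by move=> t _; rewrite derive1E; apply: derive_val.
Qed.

Lemma FTC_oscillation (f f' : R -> R) x1 x2 s t : continuous f' ->
  (forall t, is_derive t (1 : R) f (f' t)) ->
  s \in `[x1, x2] -> t \in `[x1, x2] ->
  `|f s - f t| <= \int[leb]_(r in `[x1, x2]) `|f' r|.
Proof.
move=> cf' df.
wlog st : s t / t <= s => [hw sI tI|].
  have [/hw|/ltW/hw] := leP t s; first exact.
  by rewrite distrC; exact.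
rewrite !in_itv/= => /andP[s1 s2] /andP[t1 t2].
have cnf' : continuous (fun r => `|f' r|).
  by move=> r; apply: cvg_norm; exact: cf'.
rewrite -(continuous_FTC cf' df st).
apply: le_trans (le_normr_Rintegral _ _) _ => //.
  exact: continuous_integrable_itv.
apply: fine_le.
- by apply: integrable_fin_num => //; exact: continuous_integrable_itv.
- by apply: integrable_fin_num => //; exact: continuous_integrable_itv.
apply: ge0_subset_integral => //=.
  apply: measurable_int (continuous_integrable_itv _ _ _) => //.
by apply: subset_itv; rewrite bnd_simp.
Qed.
End FTC.

Section C1.
Context {R : realType}.
Implicit Types (u v : R * R -> R).
Local Notation leb := (@lebesgue_measure R).
Local Notation D0 u := ('D_(Defs.basis (ord0 : 'I_2)) u).
Local Notation D1 u := ('D_(Defs.basis (ord_max : 'I_2)) u).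

Lemma C1_continuous u : C1 u -> continuous u.
Proof. by move=> [du _] z; exact: differentiable_continuous. Qed.

Lemma is_derive_sectionl u x y : differentiable u (x, y) ->
  is_derive x (1 : R) (fun t => u (t, y)) (D0 u (x, y)).
Proof.
move=> /diff_derivable dv.
have E : (fun h : R => h^-1 *: (u (h *: Defs.basis (ord0 : 'I_2) + (x, y)) - u (x, y))) =
         (fun h : R => h^-1 *: (u (h *: (1 : R) + x, y) - u (x, y))).
  apply/funext => h; congr (_ *: (u _ - _)).
  by rewrite /Defs.basis/= /pt; congr pair => /=; rewrite scaler0 add0r.
split; last by rewrite /derive -E.
by rewrite /derivable -E; exact: dv.
Qed.

Lemma is_derive_sectionr u x y : differentiable u (x, y) ->
  is_derive y (1 : R) (fun t => u (x, t)) (D1 u (x, y)).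
Proof.
move=> /diff_derivable dv.
have E : (fun h : R => h^-1 *: (u (h *: Defs.basis (ord_max : 'I_2) + (x, y)) - u (x, y))) =
         (fun h : R => h^-1 *: (u (x, h *: (1 : R) + y) - u (x, y))).
  apply/funext => h; congr (_ *: (u _ - _)).
  by rewrite /Defs.basis/= /pt; congr pair => /=; rewrite scaler0 add0r.
split; last by rewrite /derive -E.
by rewrite /derivable -E; exact: dv.
Qed.

Lemma C1_FTCl u x1 x2 y : C1 u -> x1 <= x2 ->
  \int[leb]_(t in `[x1, x2]) D0 u (t, y) = u (x2, y) - u (x1, y).
Proof.
move=> [du cu]; apply: (@continuous_FTC _ (fun t => u (t, y))).
  exact: (@continuous_sectionl _ (D0 u) y (cu _)).
by move=> t; exact: is_derive_sectionl.
Qed.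

Lemma C1_FTCr u x y1 y2 : C1 u -> y1 <= y2 ->
  \int[leb]_(t in `[y1, y2]) D1 u (x, t) = u (x, y2) - u (x, y1).
Proof.
move=> [du cu]; apply: (@continuous_FTC _ (fun t => u (x, t))).
  exact: (@continuous_sectionr _ (D1 u) x (cu _)).
by move=> t; exact: is_derive_sectionr.
Qed.

Lemma C1_oscillationl u x1 x2 y s t : C1 u ->
  s \in `[x1, x2] -> t \in `[x1, x2] ->
  `|u (s, y) - u (t, y)| <= \int[leb]_(r in `[x1, x2]) `|D0 u (r, y)|.
Proof.
move=> [du cu]; apply: (@FTC_oscillation _ (fun t => u (t, y))).
  exact: (@continuous_sectionl _ (D0 u) y (cu _)).
by move=> r; exact: is_derive_sectionl.
Qed.

Lemma C1_oscillationr u x y1 y2 s t : C1 u ->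
  s \in `[y1, y2] -> t \in `[y1, y2] ->
  `|u (x, s) - u (x, t)| <= \int[leb]_(r in `[y1, y2]) `|D1 u (x, r)|.
Proof.
move=> [du cu]; apply: (@FTC_oscillation _ (fun t => u (x, t))).
  exact: (@continuous_sectionr _ (D1 u) x (cu _)).
by move=> r; exact: is_derive_sectionr.
Qed.

Lemma derive_lin u v (k l : R) (w z : R * R) : C1 u -> C1 v ->
  'D_w (fun z => k * u z + l * v z) z = k * 'D_w u z + l * 'D_w v z.
Proof.
move=> [du _] [dv _].
have Du := diff_derivable (du z) (v := w).
have Dv := diff_derivable (dv z) (v := w).
by rewrite (deriveD (derivableZ Du) (derivableZ Dv)) !deriveZ.
Qed.

Lemma C1_lin u v (k l : R) : C1 u -> C1 v -> C1 (fun z => k * u z + l * v z).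
Proof.
move=> Cu Cv; have [du cu] := Cu; have [dv cv] := Cv; split=> [z|w].
  by apply: differentiableD; apply: differentiableZ.
rewrite (_ : (fun z => _) = (fun z => k * 'D_w u z + l * 'D_w v z)); last first.
  by apply/funext => z; rewrite derive_lin.
by move=> z; apply: cvgD; apply: cvgM; [exact: cvg_cst|exact: cu|exact: cvg_cst|exact: cv].
Qed.

Lemma derive_mul u v (w z : R * R) : C1 u -> C1 v ->
  'D_w (fun z => u z * v z) z = u z * 'D_w v z + v z * 'D_w u z.
Proof.
move=> [du _] [dv _].
have Du := diff_derivable (du z) (v := w).
have Dv := diff_derivable (dv z) (v := w).
by rewrite (deriveM Du Dv).
Qed.

Lemma C1_mul u v : C1 u -> C1 v -> C1 (fun z => u z * v z).
Proof.
move=> Cu Cv; have [du cu] := Cu; have [dv cv] := Cv; split=> [z|w].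
  exact: differentiableM.
rewrite (_ : (fun z => _) = (fun z => u z * 'D_w v z + v z * 'D_w u z)); last first.
  by apply/funext => z; rewrite derive_mul.
by move=> z; apply: cvgD; apply: cvgM;
  [exact: C1_continuous|exact: cv|exact: C1_continuous|exact: cu].
Qed.

End C1.

(** * Square-integrable functions *)

Section CauchySchwarz.
Context d (T : measurableType d) (R : realType).
Variables (mu : {measure set T -> \bar R}) (D : set T).
Hypothesis mD : measurable D.
Implicit Types f g : T -> R.

Lemma Rintegral_lin2 f g (k l : R) :
  mu.-integrable D (EFin \o f) -> mu.-integrable D (EFin \o g) ->
  \int[mu]_(z in D) (k * f z + l * g z) =
  k * \int[mu]_(z in D) f z + l * \int[mu]_(z in D) g z.
Proof.
move=> fi gi; rewrite RintegralD//; last 2 first.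
- exact: (integrableZl mD k fi).
- exact: (integrableZl mD l gi).
by rewrite !RintegralZl.
Qed.

Lemma integrable_lin2 f g (k l : R) :
  mu.-integrable D (EFin \o f) -> mu.-integrable D (EFin \o g) ->
  mu.-integrable D (EFin \o (fun z => k * f z + l * g z)).
Proof.
move=> fi gi.
by have := integrableD mD (integrableZl mD k fi) (integrableZl mD l gi).
Qed.

Lemma Rintegral_sqr_lin f g (k l : R) :
  mu.-integrable D (EFin \o (fun z => f z ^+ 2)) ->
  mu.-integrable D (EFin \o (fun z => g z ^+ 2)) ->
  mu.-integrable D (EFin \o (fun z => f z * g z)) ->
  \int[mu]_(z in D) ((k * f z + l * g z) ^+ 2) =
  k ^+ 2 * \int[mu]_(z in D) (f z ^+ 2) + l ^+ 2 * \int[mu]_(z in D) (g z ^+ 2)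
  + 2 * k * l * \int[mu]_(z in D) (f z * g z).
Proof.
move=> f2 g2 fg.
rewrite -Rintegral_lin2// -[X in X + _]mul1r.
rewrite -(Rintegral_lin2 1 _ (integrable_lin2 (k ^+ 2) (l ^+ 2) f2 g2))//.
by apply: eq_Rintegral => z _; ring.
Qed.

(** The quadratic form [H k l], the integral of (k f + l g)^2, is nonnegative; at k = B, l = -C it
    equals B (A B - C^2), which settles the case B > 0. *)
Lemma cauchy_schwarz f g :
  mu.-integrable D (EFin \o (fun z => f z ^+ 2)) ->
  mu.-integrable D (EFin \o (fun z => g z ^+ 2)) ->
  mu.-integrable D (EFin \o (fun z => f z * g z)) ->
  (\int[mu]_(z in D) (f z * g z)) ^+ 2 <=
  \int[mu]_(z in D) (f z ^+ 2) * \int[mu]_(z in D) (g z ^+ 2).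
Proof.
move=> f2 g2 fg.
set A := \int[mu]_(z in D) (f z ^+ 2); set B := \int[mu]_(z in D) (g z ^+ 2).
set C := \int[mu]_(z in D) (f z * g z).
have A0 : 0 <= A by apply: Rintegral_ge0 => z _; exact: sqr_ge0.
have H k l : 0 <= k ^+ 2 * A + l ^+ 2 * B + 2 * k * l * C.
  by rewrite -Rintegral_sqr_lin//; apply: Rintegral_ge0 => z _; exact: sqr_ge0.
have := H B (- C); have := H C (-1); have := H (-1) C.
have B0 : 0 <= B by apply: Rintegral_ge0 => z _; exact: sqr_ge0.
have [B00|Bn0] := eqVneq B 0.
  (* When B = 0, the form takes at this point the value -C^2 (A + 2) / (A + 1)^2, which forces C =
     0. The shift by 1 avoids a division by A, which may vanish. *)
  have := H (- C * (A + 1)^-1) 1; rewrite B00 => + _ _ _.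
  have A1 : 0 < A + 1 by lra.
  have -> : (- C * (A + 1)^-1) ^+ 2 * A + 1 ^+ 2 * 0 + 2 * (- C * (A + 1)^-1) * 1 * C
     = C ^+ 2 * (A * (A + 1)^-2 - 2 * (A + 1)^-1) by field; rewrite gt_eqF.
  have -> : A * (A + 1)^-2 - 2 * (A + 1)^-1 = - ((A + 2) / (A + 1) ^+ 2) by field; rewrite gt_eqF.
  rewrite mulrN oppr_ge0 mulr0 pmulr_lle0//.
  by rewrite divr_gt0 ?exprn_gt0//; lra.
move=> _ _ HB; rewrite -subr_ge0 -(pmulr_lge0 _ (_ : 0 < B)) ?lt0r ?Bn0//.
by move: HB; rewrite (_ : B ^+ 2 * A + _ + _ = (A * B - C ^+ 2) * B)//; ring.
Qed.
End CauchySchwarz.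

Section L2.
Context {R : realType}.
Variable D : set (R * R).
Hypothesis mD : @measurable _ (plane R) D.
Implicit Types f g : R * R -> R.

Local Notation sq f := (\int[area]_(z in D) (f z ^+ 2)).
Local Notation ip f g := (\int[area]_(z in D) (f z * g z)).

Lemma L2_measurable f : L2 D f -> @measurable_fun _ _ (plane R) (measurableTypeR R) D f.
Proof. by case. Qed.

Lemma L2_integrable_sqr f : L2 D f -> area.-integrable D (EFin \o (fun z => f z ^+ 2)).
Proof. by case. Qed.

Lemma L2_integrable_mul f g : L2 D f -> L2 D g ->
  area.-integrable D (EFin \o (fun z => f z * g z)).
Proof.
move=> Lf Lg.
have [mf mg] := (L2_measurable Lf, L2_measurable Lg).
have [f2 g2] := (L2_integrable_sqr Lf, L2_integrable_sqr Lg).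
have H := integrable_lin2 mD 1 1 f2 g2.
apply: le_integrable H => //.
  by apply/measurable_EFinP; exact: measurable_funM.
move=> z Dz /=; rewrite lee_fin !mul1r.
have H2 (x y : R) : `|x * y| <= `|x ^+ 2 + y ^+ 2|.
  by rewrite (le_trans _ (ler_norm _))// ler_norml; apply/andP; split; nra.
exact: H2.
Qed.

Lemma L2_lin f g (k l : R) : L2 D f -> L2 D g -> L2 D (fun z => k * f z + l * g z).
Proof.
move=> Lf Lg; split.
  by apply: measurable_funD; apply: measurable_funM => //; [case: Lf|case: Lg].
have H := integrable_lin2 mD 1 (2 * k * l)
  (integrable_lin2 mD (k ^+ 2) (l ^+ 2) (L2_integrable_sqr Lf) (L2_integrable_sqr Lg))
  (L2_integrable_mul Lf Lg).
by apply: eq_integrable H => // z _ /=; congr EFin; ring.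
Qed.

Lemma L2_sqr_lin f g (k l : R) : L2 D f -> L2 D g ->
  sq (fun z => k * f z + l * g z) = k ^+ 2 * sq f + l ^+ 2 * sq g + 2 * k * l * ip f g.
Proof.
move=> Lf Lg; apply: Rintegral_sqr_lin => //; [exact: L2_integrable_sqr..|].
exact: L2_integrable_mul.
Qed.

Lemma L2_cauchy_schwarz f g : L2 D f -> L2 D g -> (ip f g) ^+ 2 <= sq f * sq g.
Proof.
move=> Lf Lg; apply: cauchy_schwarz => //; [exact: L2_integrable_sqr..|].
exact: L2_integrable_mul.
Qed.

Lemma sqr_integral_ge0 f : 0 <= sq f.
Proof. by apply: Rintegral_ge0 => z _; exact: sqr_ge0. Qed.

Lemma continuous_L2 f : continuous f -> (exists x1 x2 y1 y2, D = rect x1 x2 y1 y2) -> L2 D f.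
Proof.
move=> cf [x1 [x2 [y1 [y2 DE]]]]; rewrite DE; split.
  by apply: continuous_measurable_plane => //; exact: measurable_rect.
have H : continuous (fun z => f z ^+ 2).
  by move=> z; apply: cvgM; exact: cf.
exact: (continuous_integrable_rect x1 x2 y1 y2 H).
Qed.
End L2.

(** * Completeness of L^2 with geometric rates *)

Section RieszFischer.
Context d (T : measurableType d) (R : realType).
Variables (mu : {measure set T -> \bar R}) (D : set T).
Hypothesis mD : measurable D.
Implicit Types (f h : nat -> T -> R).

Lemma half_series (e : R) : 0 <= e ->
  (\sum_(0 <= n <oo) (e / 2 ^+ n.+1)%:E <= e%:E)%E.
Proof.
move=> e0.
have := @epsilon_trick R (fun=> 0%E) e xpredT (fun=> lexx _) e0.
rewrite [X in (_ <= X + _)%E]eseries0// add0e; apply: le_trans.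
apply: lee_nneseries => n _; first by rewrite lee_fin divr_ge0// exprn_ge0.
by rewrite add0e natrX.
Qed.

Lemma integrable_sqrP (u : T -> R) (M : R) : measurable_fun D u ->
  (\int[mu]_(z in D) (u z ^+ 2)%:E <= M%:E)%E ->
  mu.-integrable D (EFin \o (fun z => u z ^+ 2)) /\
  \int[mu]_(z in D) (u z ^+ 2) <= M.
Proof.
move=> mu' H.
have mu2 : measurable_fun D (EFin \o (fun z => u z ^+ 2)).
  by apply/measurable_EFinP; exact: measurable_funX.
have I : mu.-integrable D (EFin \o (fun z => u z ^+ 2)).
  apply/integrableP; split => //.
  under eq_integral => z _ do rewrite /= ger0_norm ?sqr_ge0//.
  by rewrite (le_lt_trans H)// ltry.
split=> //; rewrite -lee_fin /Rintegral fineK//.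
exact: integrable_fin_num.
Qed.

(** Fatou's lemma applied to the squares. Square-integrability of the limit is a conclusion and not
    a hypothesis: it comes with the bound. *)
Lemma fatou_sqr h (u : T -> R) (M : R) :
  (forall k, measurable_fun D (h k)) -> measurable_fun D u ->
  (forall k, mu.-integrable D (EFin \o (fun z => h k z ^+ 2))) ->
  (forall k, \int[mu]_(z in D) (h k z ^+ 2) <= M) ->
  {ae mu, forall z, D z -> h k z @[k --> \oo] --> u z} ->
  mu.-integrable D (EFin \o (fun z => u z ^+ 2)) /\
  \int[mu]_(z in D) (u z ^+ 2) <= M.
Proof.
move=> mh mu' hi hM hu; apply: integrable_sqrP => //.
pose g k z := (h k z ^+ 2)%:E.
have mg k : measurable_fun D (g k).
  by apply/measurable_EFinP; exact: measurable_funX.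
have g0 k z : D z -> (0 <= g k z)%E by move=> _; rewrite lee_fin sqr_ge0.
have Ig k : (\int[mu]_(z in D) g k z <= M%:E)%E.
  have /fineK <- : (\int[mu]_(z in D) g k z)%E \is a fin_num.
    by apply: integrable_fin_num => //; exact: hi.
  by rewrite lee_fin; exact: hM.
have einf0 z : D z -> (0 <= limn_einf (g^~ z))%E.
  move=> Dz; rewrite limn_einf_lim; apply: lime_ge; first exact: is_cvg_einfs.
  by apply: nearW => n; apply: le_ereal_inf_tmp => _ [k _ <-]; exact: g0.
have -> : (\int[mu]_(z in D) (u z ^+ 2)%:E =
    \int[mu]_(z in D) limn_einf (g^~ z))%E.
  apply: ge0_ae_eq_integral => //.
  - by apply/measurable_EFinP; exact: measurable_funX.
  - apply: measurableT_comp => //; apply: measurable_fun_limn_esup => n.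
    exact: measurableT_comp.
  - by move=> z _; rewrite lee_fin sqr_ge0.
  - move: hu; apply: filterS => z hz Dz.
    have cg : (g^~ z) @ \oo --> (u z ^+ 2)%:E.
      apply: cvg_EFin; first exact: nearW.
      by apply: cvgM; exact: hz.
    by rewrite is_cvg_limn_einfE; [exact/esym/cvg_lim|apply/cvg_ex; eexists; exact: cg].
apply: le_trans (fatou mu mD mg g0) _.
rewrite limn_einf_lim; apply: lime_le; first exact: is_cvg_einfs.
apply: nearW => n; apply: le_trans (Ig n); apply: ereal_inf_lbound.
by exists n => /=.
Qed.

(** The series of the 4^k (h k)^2 has integral at most the sum of the c / 2^k, that is 2 c, so it is
    finite almost everywhere. Its value C bounds every term, whence 2^k |h k| is at most the square
    root of C, and so at most C + 1. *)
Lemma ae_geometric_bound h (c : R) : 0 <= c ->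
  (forall k, measurable_fun D (h k)) ->
  (forall k, mu.-integrable D (EFin \o (fun z => h k z ^+ 2))) ->
  (forall k, \int[mu]_(z in D) (h k z ^+ 2) <= c / 8 ^+ k) ->
  {ae mu, forall z, D z -> exists2 C, 0 <= C & forall k, `|h k z| <= C / 2 ^+ k}.
Proof.
move=> c0 mh hi hc.
pose g k z := (4 ^+ k * h k z ^+ 2)%:E.
have mg k : measurable_fun D (g k).
  by apply/measurable_EFinP; apply: measurable_funM => //; exact: measurable_funX.
have g0 k z : D z -> (0 <= g k z)%E.
  by move=> _; rewrite lee_fin mulr_ge0 ?sqr_ge0 ?exprn_ge0.
have Ig k : (\int[mu]_(z in D) g k z <= (2 * c / 2 ^+ k.+1)%:E)%E.
  have I : mu.-integrable D (g k) by exact: (integrableZl mD (4 ^+ k) (hi k)).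
  have /fineK <- := integrable_fin_num mD I.
  rewrite lee_fin [leLHS](_ : _ = 4 ^+ k * \int[mu]_(z in D) (h k z ^+ 2)); last first.
    exact: RintegralZl.
  rewrite -ler_pdivlMl ?exprn_gt0//; apply: le_trans (hc k) _.
  rewrite (_ : 8 = 4 * 2 :> R); last by ring.
  rewrite exprMn exprS le_eqVlt; apply/orP; left; apply/eqP; field.
  by rewrite !expf_neq0.
have mG : measurable_fun D (fun z => \sum_(0 <= k <oo) g k z)%E.
  by apply: (@ge0_emeasurable_sum _ _ _ _ g xpredT) => [k z Dz _|k _]; [exact: g0|exact: mg].
have IG : mu.-integrable D (fun z => \sum_(0 <= k <oo) g k z)%E.
  apply/integrableP; split => //.
  under eq_integral => z /[!inE] Dz.
    rewrite gee0_abs; last by apply: nneseries_ge0 => k _ _; exact: g0.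
    over.
  rewrite integral_nneseries//.
  apply: (@le_lt_trans _ _ (2 * c)%:E); last exact: ltry.
  apply: le_trans (half_series _); last by rewrite mulr_ge0.
  apply: lee_nneseries => k _; last exact: Ig.
  by move=> _; apply: integral_ge0 => z; exact: g0.
move: (integrable_ae mD IG); apply: filterS => z Gz Dz.
have /fineK GE := Gz Dz; set C := fine _ in GE.
have C0 : 0 <= C by rewrite fine_ge0// nneseries_ge0// => k _ _; exact: g0.
exists (C + 1); first by rewrite addr_ge0.
move=> k; have : (g k z <= C%:E)%E.
  rewrite GE; apply: le_trans (nneseries_lim_ge k.+1 _); last by move=> n _ _; exact: g0.
  by rewrite big_nat_recr//= leeDr// sume_ge0// => n _; exact: g0.
rewrite lee_fin => H.
have k2 : 0 < 2 ^+ k :> R by rewrite exprn_gt0.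
rewrite ler_pdivlMr// -(ger0_norm (ltW k2)) -normrM.
have : (h k z * 2 ^+ k) ^+ 2 <= C.
  apply: le_trans H; rewrite (_ : 4 = 2 * 2 :> R); last by ring.
  by rewrite exprMn [in leRHS]exprMn le_eqVlt; apply/orP; left; apply/eqP; ring.
move: (h k z * 2 ^+ k) => t tC.
by rewrite ler_norml; apply/andP; split; nra.
Qed.

(** The limit is defined everywhere as the real part of a limsup, which makes it measurable by
    construction; almost everywhere it is the pointwise limit, since the increments decay
    geometrically. The bounds pass to it by Fatou's lemma. Only differences are assumed
    square-integrable. *)
Lemma Riesz_Fischer h (c : R) : 0 <= c ->
  (forall k, measurable_fun D (h k)) ->
  (forall k n, mu.-integrable D (EFin \o (fun z => (h k z - h n z) ^+ 2))) ->
  (forall n k, (n <= k)%N -> \int[mu]_(z in D) ((h k z - h n z) ^+ 2) <= c / 8 ^+ n) ->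
  exists u : T -> R, measurable_fun D u /\
    forall n, mu.-integrable D (EFin \o (fun z => (u z - h n z) ^+ 2)) /\
      \int[mu]_(z in D) ((u z - h n z) ^+ 2) <= c / 8 ^+ n.
Proof.
move=> c0 mh hi hc.
pose u z := fine (limn_esup (fun n => (h n z)%:E)).
have mu' : measurable_fun D u.
  apply: measurableT_comp => //; apply: measurable_fun_limn_esup => n.
  exact/measurable_EFinP.
have := @ae_geometric_bound (fun k z => h k.+1 z - h k z) c c0
  (fun k => measurable_funB (mh _) (mh _)) (fun k => hi _ _) (fun k => hc _ _ (leqnSn _)).
have {}mB k n : measurable_fun D (fun z => h k z - h n z).
  exact: measurable_funB.
move=> H; have {H} hu : {ae mu, forall z, D z -> h k z @[k --> \oo] --> u z}.
  move: H; apply: filterS => z H Dz; have [C C0 HC] := H Dz.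
  have ch : cvgn (h^~ z).
    have -> : h^~ z = (fun n => h 0%N z + series (fun k => h k.+1 z - h k z) n).
      by apply/funext => n; rewrite /series/= telescope_sumr// addrC subrK.
    apply: is_cvgD; first exact: is_cvg_cst.
    apply: normed_cvg; apply: (@series_le_cvg _ _ (geometric C 2^-1)) => //.
    - by move=> n; exact: normr_ge0.
    - by move=> n; rewrite /geometric/= mulr_ge0// exprn_ge0// invr_ge0.
    - by move=> n; rewrite /geometric/= exprVn.
    - by apply: is_cvg_geometric_series; rewrite ger0_norm ?invr_ge0// invf_lt1// ltr1n.
  have ce : (fun n => (h n z)%:E) @ \oo --> (limn (h^~ z))%:E.
    by apply: cvg_EFin => //; exact: nearW.
  rewrite /u is_cvg_limn_esupE; last by apply/cvg_ex; eexists; exact: ce.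
  by rewrite (cvg_lim _ ce).
exists u; split=> // n.
apply: (@fatou_sqr (fun k z => h (k + n)%N z - h n z)) => //.
- exact: measurable_funB.
- by move=> k; apply: hc; rewrite leq_addl.
- move: hu; apply: filterS => z hz Dz; apply: cvgB; last exact: cvg_cst.
  by rewrite (cvg_shiftn n (h^~ z)); exact: hz.
Qed.
End RieszFischer.

(** * Hausdorff content of superlevel sets *)

(** A bound on the one-dimensional Hausdorff content, witnessed by a covering. [hausdorff1_null N]
    unfolds to [content_le N e] for all positive [e]. *)
Definition content_le {R : realType} (E : set (R * R)) (e : R) : Prop :=
  exists (c : nat -> R * R) (r : nat -> R),
    [/\ forall k, 0 <= r k, E `<=` \bigcup_k ball (c k) (r k) &
        (\sum_(0 <= k <oo) (r k)%:E <= e%:E)%E].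

Section HausdorffContent.
Context {R : realType}.
Implicit Types (E F : set (R * R)) (e f : R).

Lemma content_leS E F e f : E `<=` F -> f <= e -> content_le F f -> content_le E e.
Proof.
move=> EF fe [c [r [r0 Fcr rf]]]; exists c, r; split=> //.
  exact: subset_trans Fcr.
by apply: le_trans rf _; rewrite lee_fin.
Qed.

(** The ball is completed into a sequence by balls of radius 0, which are empty and cost nothing. *)
Lemma content_le_ball (c : R * R) (r : R) : 0 <= r -> content_le (ball c r) r.
Proof.
move=> r0; exists (fun=> c), (fun k => if k == 0%N then r else 0); split.
- by move=> k; case: ifP.
- by move=> z cz; exists 0%N.
- rewrite (nneseries_split 0 1)/=; last by move=> k _; rewrite lee_fin; case: ifP.
  rewrite big_mkord big_ord1/= add0n eseries0 ?adde0//.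
  by move=> [|k].
Qed.

Lemma content_le0 e : 0 <= e -> content_le (@set0 (R * R)) e.
Proof. by move=> e0; apply: content_leS e0 (content_le_ball 0 (lexx 0)). Qed.

Lemma content_le_ge0 E e : content_le E e -> 0 <= e.
Proof.
move=> [c [r [r0 _ re]]]; rewrite -lee_fin (le_trans _ re)//.
by apply: nneseries_ge0 => k _ _; rewrite lee_fin.
Qed.

(** The double family of balls is enumerated through a bijection between [nat] and [nat * nat], and
    nonnegativity allows the sum to be rearranged. *)
Lemma content_le_bigcup (E : nat -> set (R * R)) (e : nat -> R) f :
  (forall n, content_le (E n) (e n)) -> (\sum_(0 <= n <oo) (e n)%:E <= f%:E)%E ->
  content_le (\bigcup_n E n) f.
Proof.
move=> H ef.
have /choice[c /choice[r cr]] : forall n, exists c, exists r, [/\ forall k, 0 <= r k,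
    E n `<=` \bigcup_k ball (c k) (r k) & (\sum_(0 <= k <oo) (r k)%:E <= (e n)%:E)%E].
  exact: H.
have r0 n k : 0 <= r n k by have [+ _ _] := cr n; exact.
have /card_esym/ppcard_eqP[g] := card_nat2.
exists (fun m => c (g m).1 (g m).2), (fun m => r (g m).1 (g m).2); split.
- by move=> k; exact: r0.
- move=> z [n _ Enz]; have [_ + _] := cr n => /(_ z Enz)[k _ zk].
  by exists (g^-1%FUN (n, k)) => //=; rewrite invK ?inE.
- apply: le_trans ef.
  rewrite nneseries_esumT; last by move=> m; rewrite lee_fin.
  have bg : set_bij [set: nat] [set: nat * nat] g by exact: bij.
  rewrite -(@reindex_esum R _ _ _ _ _ (fun p => (r p.1 p.2)%:E) bg).
  have -> : [set: nat * nat] = [set: nat] `*`` (fun=> [set: nat]) by apply/seteqP.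
  rewrite -(@esum_esum R _ _ setT (fun=> setT) (fun n k => (r n k)%:E)); last first.
    by move=> i j _ _; rewrite lee_fin.
  rewrite -nneseries_esumT; last first.
    by move=> n; apply: esum_ge0 => k _; rewrite lee_fin.
  apply: lee_nneseries => n _.
    by move=> _; apply: esum_ge0 => k _; rewrite lee_fin.
  rewrite -nneseries_esumT; last by move=> k; rewrite lee_fin.
  by have [_ _] := cr n.
Qed.

Lemma content_leU E F e f : content_le E e -> content_le F f ->
  content_le (E `|` F) (e + f).
Proof.
move=> HE HF; have e0 := content_le_ge0 HE; have f0 := content_le_ge0 HF.
pose EF n := if n is n'.+1 then if n' is n''.+1 then set0 else F else E.
pose ef n := if n is n'.+1 then if n' is n''.+1 then 0 else f else e.
apply: (@content_leS _ (\bigcup_n EF n) _ (e + f)) => //.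
  by move=> z [Ez|Fz]; [exists 0%N|exists 1%N].
apply: (@content_le_bigcup _ ef); first by move=> [|[|n]] //=; exact: content_le0.
rewrite (nneseries_split 0 2)/=; last by move=> [|[|k]] _; rewrite lee_fin.
rewrite big_mkord !big_ord_recl big_ord0/= adde0 eseries0 ?adde0//.
by move=> [|[|k]].
Qed.

Lemma hausdorff1_nullU (N M : set (R * R)) :
  hausdorff1_null N -> hausdorff1_null M -> hausdorff1_null (N `|` M).
Proof.
move=> HN HM e e0; rewrite (splitr e).
by apply: content_leU; [apply: HN|apply: HM]; rewrite divr_gt0.
Qed.

End HausdorffContent.

(** * Choosing lines by averaging over rectangles *)

Section RectIntegrals.
Context {R : realType}.
Implicit Types (F : R * R -> R).
Local Notation leb := (@lebesgue_measure R).

Lemma Rintegral_cst_itv (M x1 x2 : R) : x1 <= x2 ->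
  \int[leb]_(_ in `[x1, x2]) M = M * (x2 - x1).
Proof.
move=> x12; rewrite Rintegral_cst//; congr (_ * _).
exact: (congr1 fine (lebesgue_itvcc x12)).
Qed.

Lemma Rintegral_itv_le_cst (f : R -> R) (M x1 x2 : R) : continuous f -> x1 <= x2 ->
  (forall t, t \in `[x1, x2] -> f t <= M) ->
  \int[leb]_(t in `[x1, x2]) f t <= M * (x2 - x1).
Proof.
move=> cf x12 fM; rewrite -Rintegral_cst_itv//.
apply: le_Rintegral => //.
- exact: continuous_integrable_itv.
- by apply: continuous_integrable_itv; exact: cst_continuous.
Qed.

Lemma exists_itv_lt_average (f : R -> R) (M x1 x2 : R) : x1 <= x2 ->
  leb.-integrable `[x1, x2] (EFin \o f) ->
  \int[leb]_(t in `[x1, x2]) f t < M * (x2 - x1) ->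
  exists2 t, t \in `[x1, x2] & f t < M.
Proof.
move=> x12 fi fM; apply: contrapT => H; move: fM; apply/negP; rewrite -leNgt.
rewrite -Rintegral_cst_itv//; apply: le_Rintegral => //.
  by apply: continuous_integrable_itv; exact: cst_continuous.
by move=> t tI; rewrite leNgt; apply/negP => ft; apply: H; exists t.
Qed.

Lemma exists_section_lt_averagel F (M x1 x2 y1 y2 : R) : continuous F -> x1 <= x2 ->
  \int[area]_(z in rect x1 x2 y1 y2) F z < M * (x2 - x1) ->
  exists2 x, x \in `[x1, x2] & \int[leb]_(y in `[y1, y2]) F (x, y) < M.
Proof.
by move=> cF x12; have [Fi ->] := fubini_rectl x1 x2 y1 y2 cF; exact: exists_itv_lt_average.
Qed.

Lemma exists_section_lt_averager F (M x1 x2 y1 y2 : R) : continuous F -> y1 <= y2 ->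
  \int[area]_(z in rect x1 x2 y1 y2) F z < M * (y2 - y1) ->
  exists2 y, y \in `[y1, y2] & \int[leb]_(x in `[x1, x2]) F (x, y) < M.
Proof.
by move=> cF y12; have [Fi ->] := fubini_rectr x1 x2 y1 y2 cF; exact: exists_itv_lt_average.
Qed.

Lemma Rintegral_itv_split (f : R -> R) (x1 x2 x3 : R) : x1 <= x2 <= x3 ->
  leb.-integrable `[x1, x3] (EFin \o f) ->
  \int[leb]_(t in `[x1, x3]) f t =
  \int[leb]_(t in `[x1, x2]) f t + \int[leb]_(t in `[x2, x3]) f t.
Proof.
move=> /andP[x12 x23] fi.
have := @Rintegral_itvB R f (BLeft x1) (BRight x3) x2 fi.
rewrite !bnd_simp => /(_ x12 x23) /eqP; rewrite subr_eq => /eqP ->.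
rewrite addrC; congr (_ + _); apply: Rintegral_itv_obnd_cbnd.
by apply: integrableS fi => //; apply: subset_itv; rewrite bnd_simp.
Qed.

Lemma Rintegral_rect_splitl F (x1 x2 x3 y1 y2 : R) : continuous F -> x1 <= x2 <= x3 ->
  \int[area]_(z in rect x1 x3 y1 y2) F z =
  \int[area]_(z in rect x1 x2 y1 y2) F z + \int[area]_(z in rect x2 x3 y1 y2) F z.
Proof.
move=> cF x123; have [Fi E] := fubini_rectl x1 x3 y1 y2 cF.
rewrite E (fubini_rectl x1 x2 y1 y2 cF).2 (fubini_rectl x2 x3 y1 y2 cF).2.
exact: Rintegral_itv_split.
Qed.

Lemma Rintegral_rect_splitr F (x1 x2 y1 y2 y3 : R) : continuous F -> y1 <= y2 <= y3 ->
  \int[area]_(z in rect x1 x2 y1 y3) F z =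
  \int[area]_(z in rect x1 x2 y1 y2) F z + \int[area]_(z in rect x1 x2 y2 y3) F z.
Proof.
move=> cF y123; have [Fi E] := fubini_rectr x1 x2 y1 y3 cF.
rewrite E (fubini_rectr x1 x2 y1 y2 cF).2 (fubini_rectr x1 x2 y2 y3 cF).2.
exact: Rintegral_itv_split.
Qed.

(** Cauchy-Schwarz against the constant 1, whose squared norm is the area of the rectangle. *)
Lemma Rintegral_rect_norm_lt F (m x1 x2 y1 y2 : R) : continuous F ->
  x1 <= x2 -> y1 <= y2 -> 0 < m ->
  (x2 - x1) * (y2 - y1) * \int[area]_(z in rect x1 x2 y1 y2) (F z ^+ 2) < m ^+ 2 ->
  \int[area]_(z in rect x1 x2 y1 y2) `|F z| < m.
Proof.
move=> cF x12 y12 m0 H.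
have mr := measurable_rect x1 x2 y1 y2.
have cn : continuous (fun z => `|F z|) by move=> z; apply: cvg_norm; exact: cF.
have c2 : continuous (fun z => F z ^+ 2) by move=> z; apply: cvgM; exact: cF.
have := @cauchy_schwarz _ _ R area _ mr (fun z => `|F z|) (fun=> 1).
have -> : (fun z => `|F z| ^+ 2) = (fun z => F z ^+ 2).
  by apply/funext => z; rewrite real_normK ?num_real.
have -> : (fun z => `|F z| * 1) = (fun z => `|F z|) by apply/funext => z; rewrite mulr1.
rewrite Rintegral_cst// area_rect//= expr1n mul1r => /(_ _ _ _) CS.
have {CS}CS := CS
  (continuous_integrable_rect _ _ _ _ c2)
  (continuous_integrable_rect _ _ _ _ (@cst_continuous _ _ _))
  (continuous_integrable_rect _ _ _ _ cn).
rewrite -(ltr_pXn2r (n := 2))// ?nnegrE ?(ltW m0)//; last first.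
  by apply: Rintegral_ge0.
by apply: le_lt_trans CS _; rewrite mulrC.
Qed.

End RectIntegrals.

Section Thresholds.
Context {R : realType}.

Lemma two_sixteenths (l : R) : 0 < l -> l / 16 + l / 16 <= l / 4.
Proof. by move=> l0; lra. Qed.

(** Halving the side while multiplying the threshold by 3/4 divides their ratio by 3/2. Hence a
    Lipschitz bound eventually beats the threshold, and the subdivision stops. *)
Lemma half_scale (L s t e l : R) : L * (s * t) <= 3 / 2 * e * l ->
  L * (s / 2 * t) <= e * (3 / 4 * l).
Proof. by move=> H; lra. Qed.

Lemma oscillation_step (x y z l : R) : `|y - z| <= l / 4 -> l < `|x - z| ->
  3 / 4 * l < `|x - y|.
Proof.
by move=> yz lxz; have := ler_normD (x - y) (y - z); rewrite addrA subrK; lra.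
Qed.

End Thresholds.

(** * Recursive subdivision of a rectangle *)

Section Capacity.
Context {R : realType}.
Variables (a b : R).
Hypotheses (a0 : 0 < a) (b0 : 0 < b).
Implicit Types (u : R * R -> R).
Local Notation leb := (@lebesgue_measure R).
Local Notation D0 u := ('D_(Defs.basis (ord0 : 'I_2)) u).
Local Notation D1 u := ('D_(Defs.basis (ord_max : 'I_2)) u).

Definition gradsq u (z : R * R) : R := D0 u z ^+ 2 + D1 u z ^+ 2.

Lemma continuous_gradsq u : C1 u -> continuous (gradsq u).
Proof.
by move=> [_ cu] z; apply: cvgD; apply: cvgM; exact: cu.
Qed.

Lemma gradsq_ge0 u z : 0 <= gradsq u z.
Proof. by rewrite addr_ge0// sqr_ge0. Qed.

Local Notation Q x y s := (rect x (x + s * a) y (y + s * b)).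

(** Balls are open squares for the sup norm: the radius has to exceed both [s * a] and [s * b], and
    their sum does. *)
Lemma rect_sub_ball (x y s : R) : 0 < s -> Q x y s `<=` ball (x, y) (s * (a + b)).
Proof.
move=> s0 [u v] /in_rect[xu ux yv vy].
have [sa sb] : 0 < s * a /\ 0 < s * b by rewrite !mulr_gt0.
by split; rewrite /ball/= ltr_norml; apply/andP; split; rewrite ?mulrDr; lra.
Qed.

Variables q c : R.
Hypotheses (q0 : 0 < q) (qa : 128 * q <= 3 * a) (qb : 128 * q <= 3 * b).
Hypotheses (c0 : 0 < c) (cE : q ^+ 2 = c * (a * b)).

(** The rectangle has area s^2 a b, so an energy below c l^2 gives an L^1 norm below the square root
    of s^2 a b c l^2, which is q l s. This is the meaning of [cE]: [q] is the L^1 threshold that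
    matches the energy threshold [c]. *)
Lemma rect_L1_lt (F : R * R -> R) (x y s l : R) : continuous F -> 0 < s -> 0 < l ->
  \int[area]_(z in Q x y s) (F z ^+ 2) < c * l ^+ 2 ->
  \int[area]_(z in Q x y s) `|F z| < q * (l * s).
Proof.
move=> cF s0 l0 H.
have [sa sb] : 0 < s * a /\ 0 < s * b by rewrite !mulr_gt0.
apply: Rintegral_rect_norm_lt => //; [by rewrite lerDl ltW|by rewrite lerDl ltW| |].
  by rewrite !mulr_gt0.
have -> : (x + s * a - x) * (y + s * b - y) = s * a * (s * b) by ring.
have -> : (q * (l * s)) ^+ 2 = s * a * (s * b) * (c * l ^+ 2).
  by rewrite exprMn cE; ring.
by rewrite ltr_pM2l// mulr_gt0.
Qed.

Lemma partials_L1_lt u (x y s l : R) : C1 u -> 0 < s -> 0 < l ->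
  \int[area]_(z in Q x y s) gradsq u z < c * l ^+ 2 ->
  \int[area]_(z in Q x y s) `|D0 u z| < q * (l * s) /\
  \int[area]_(z in Q x y s) `|D1 u z| < q * (l * s).
Proof.
move=> Cu s0 l0 H; have cG := continuous_gradsq Cu; have [_ cu] := Cu.
have csq i : continuous (fun z => 'D_(Defs.basis i) u z ^+ 2).
  by move=> z; apply: cvgM; exact: cu.
split; apply: rect_L1_lt => //; apply: le_lt_trans H; apply: le_Rintegral.
- exact: measurable_rect.
- exact: continuous_integrable_rect.
- exact: continuous_integrable_rect.
- by move=> z _; rewrite lerDl sqr_ge0.
- exact: measurable_rect.
- exact: continuous_integrable_rect.
- exact: continuous_integrable_rect.
- by move=> z _; rewrite lerDr sqr_ge0.
Qed.

Lemma Rintegral_rect_subset (F : R * R -> R) (x1 x2 y1 y2 x1' x2' y1' y2' : R) : continuous F ->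
  (forall z, 0 <= F z) -> rect x1' x2' y1' y2' `<=` rect x1 x2 y1 y2 ->
  \int[area]_(z in rect x1' x2' y1' y2') F z <= \int[area]_(z in rect x1 x2 y1 y2) F z.
Proof.
move=> cF F0 S; apply: fine_le.
- apply: integrable_fin_num; first exact: measurable_rect.
  exact: continuous_integrable_rect.
- apply: integrable_fin_num; first exact: measurable_rect.
  exact: continuous_integrable_rect.
apply: ge0_subset_integral => //.
- exact: measurable_rect.
- exact: measurable_rect.
- apply: measurable_int (continuous_integrable_rect _ _ _ _ cF).
- by move=> z _; rewrite lee_fin.
Qed.

(** In the half-size rectangle a vertical line at [p1'] is chosen for the next stage, with a
    variation of [u] adapted to the threshold [3 / 4 * l]. The horizontal line at [p2'] is
    controlled across the full width of the parent, so that it meets the parent's vertical line at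
    [p1]. The path from [(p1', p2')] through [(p1, p2')] to [(p1, p2)] then costs at most [l / 16]
    on each of its two legs. *)
Lemma good_cross u (x y s l x' y' p1 p2 : R) : C1 u -> 0 < s -> 0 < l ->
  x <= x' -> x' + s / 2 * a <= x + s * a -> y <= y' -> y' + s / 2 * b <= y + s * b ->
  p1 \in `[x, x + s * a] -> p2 \in `[y, y + s * b] ->
  \int[area]_(z in Q x y s) gradsq u z < c * l ^+ 2 ->
  \int[leb]_(t in `[y, y + s * b]) `|D1 u (p1, t)| < l / 16 ->
  exists p1' p2', [/\ p1' \in `[x', x' + s / 2 * a], p2' \in `[y', y' + s / 2 * b],
    \int[leb]_(t in `[y', y' + s / 2 * b]) `|D1 u (p1', t)| < 3 / 4 * l / 16 &
    `|u (p1', p2') - u (p1, p2)| <= l / 4].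
Proof.
move=> Cu s0 l0 xx' x'x yy' y'y p1I p2J small D1l.
have [_ cu] := Cu.
have cn i : continuous (fun z => `|'D_(Defs.basis i) u z|).
  by move=> z; apply: cvg_norm; exact: cu.
have [D0s D1s] := partials_L1_lt Cu s0 l0 small.
have ls : 0 < l * s by rewrite mulr_gt0.
have s2 : 0 < s / 2 by rewrite divr_gt0.
have [sa2 sb2] : 0 < s / 2 * a /\ 0 < s / 2 * b by rewrite !mulr_gt0.
have II : `[x', x' + s / 2 * a] `<=` `[x, x + s * a].
  by apply: subset_itv; rewrite bnd_simp.
have JJ : `[y', y' + s / 2 * b] `<=` `[y, y + s * b].
  by apply: subset_itv; rewrite bnd_simp.
have [p1' p1'I D1p] : exists2 t, t \in `[x', x' + s / 2 * a] &
    \int[leb]_(r in `[y', y' + s / 2 * b]) `|D1 u (t, r)| < 3 / 4 * l / 16.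
  apply: (@exists_section_lt_averagel _ (fun z => `|D1 u z|)) => //.
    by rewrite lerDl ltW.
  apply: (@le_lt_trans _ _ (\int[area]_(z in Q x y s) `|D1 u z|)).
    by apply: Rintegral_rect_subset => //; exact: setSX.
  apply: lt_le_trans D1s _.
  (* The average is taken over the width [s / 2 * a]: hence the requirement [128 * q <= 3 * a]. The
     horizontal line, with threshold [l / 16], only needs [128 * q <= 4 * b]. *)
  rewrite (_ : 3 / 4 * l / 16 * _ = 3 * a / 128 * (l * s)); last by field.
  by rewrite ler_pM2r// ler_pdivlMr// mulrC.
have [p2' p2'J D0p] : exists2 t, t \in `[y', y' + s / 2 * b] &
    \int[leb]_(r in `[x, x + s * a]) `|D0 u (r, t)| < l / 16.
  apply: (@exists_section_lt_averager _ (fun z => `|D0 u z|)) => //.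
    by rewrite lerDl ltW.
  apply: (@le_lt_trans _ _ (\int[area]_(z in Q x y s) `|D0 u z|)).
    by apply: Rintegral_rect_subset => //; exact: setSX.
  apply: lt_le_trans D0s _.
  rewrite (_ : l / 16 * _ = 4 * b / 128 * (l * s)); last by field.
  rewrite ler_pM2r// ler_pdivlMr// mulrC (le_trans qb)// ler_pM2r// ler_nat.
  by [].
exists p1', p2'; split => //.
rewrite (_ : _ - _ = (u (p1', p2') - u (p1, p2')) + (u (p1, p2') - u (p1, p2))); last by ring.
apply: (@le_trans _ _ (l / 16 + l / 16)); last exact: two_sixteenths.
apply: le_trans (ler_normD _ _) _; apply: lerD.
  by apply: le_trans (ltW D0p); apply: C1_oscillationl => //; exact: II.
by apply: le_trans (ltW D1l); apply: C1_oscillationr => //; exact: JJ.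
Qed.

(** This ends the recursion: once [L * (s * (a + b))] is at most the threshold, the superlevel set
    is empty. *)
Lemma oscillation_le_lipschitz u (L x y s p1 p2 : R) z : C1 u -> 0 < s ->
  p1 \in `[x, x + s * a] -> p2 \in `[y, y + s * b] ->
  (forall z, Q x y s z -> `|D0 u z| <= L /\ `|D1 u z| <= L) ->
  Q x y s z -> `|u z - u (p1, p2)| <= L * (s * (a + b)).
Proof.
case: z => t1 t2 Cu s0 p1I p2J uL [/= t1I t2J]; have [_ cu] := Cu.
have [sa sb] : 0 < s * a /\ 0 < s * b by rewrite !mulr_gt0.
have cn i : continuous (fun z => `|'D_(Defs.basis i) u z|).
  by move=> z; apply: cvg_norm; exact: cu.
rewrite (_ : _ - _ = (u (t1, t2) - u (p1, t2)) + (u (p1, t2) - u (p1, p2))); last by ring.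
apply: le_trans (ler_normD _ _) _; rewrite mulrDr mulrDr; apply: lerD.
  apply: le_trans (C1_oscillationl _ Cu t1I p1I) _.
  have := @Rintegral_itv_le_cst _ (fun t => `|D0 u (t, t2)|) L x (x + s * a).
  rewrite (_ : x + s * a - x = s * a); last by ring.
  apply; first exact: (@continuous_sectionl _ (fun z => `|D0 u z|) t2 (cn _)).
    by rewrite lerDl ltW.
  by move=> t tI; apply: (uL _ _).1.
apply: le_trans (C1_oscillationr _ Cu t2J p2J) _.
have := @Rintegral_itv_le_cst _ (fun t => `|D1 u (p1, t)|) L y (y + s * b).
rewrite (_ : y + s * b - y = s * b); last by ring.
apply; first exact: (@continuous_sectionr _ (fun z => `|D1 u z|) p1 (cn _)).
  by rewrite lerDl ltW.
by move=> t tI; apply: (uL _ _).2.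
Qed.

Lemma rect_quarters (F : R * R -> R) (x y s : R) : continuous F -> 0 < s ->
  \int[area]_(z in Q x y s) F z =
  \int[area]_(z in Q x y (s / 2)) F z +
  \int[area]_(z in Q x (y + s / 2 * b) (s / 2)) F z +
  (\int[area]_(z in Q (x + s / 2 * a) y (s / 2)) F z +
   \int[area]_(z in Q (x + s / 2 * a) (y + s / 2 * b) (s / 2)) F z).
Proof.
move=> cF s0; have s2 : 0 < s / 2 by rewrite divr_gt0.
have [sa2 sb2] : 0 < s / 2 * a /\ 0 < s / 2 * b by rewrite !mulr_gt0.
have ea : x + s / 2 * a + s / 2 * a = x + s * a by field.
have eb : y + s / 2 * b + s / 2 * b = y + s * b by field.
rewrite ea eb.
rewrite (@Rintegral_rect_splitl _ F x (x + s / 2 * a))//; last first.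
  by rewrite -ea !lerDl !ltW.
by congr (_ + _); rewrite (@Rintegral_rect_splitr _ F _ _ y (y + s / 2 * b))// -eb !lerDl !ltW.
Qed.

(* Either the energy of the rectangle is at least [c * l ^+ 2] and one ball pays
   for it, or it is split in four: in each quarter a vertical and a horizontal
   line with small oscillation are joined to [(p1, p2)], and the threshold
   decreases only by the factor [3 / 4 > 1 / sqrt 2], so that the bounds add up. *)
Lemma content_rect_oscillation u (L : R) n (x y s l p1 p2 : R) : C1 u -> 0 < s -> 0 < l ->
  p1 \in `[x, x + s * a] -> p2 \in `[y, y + s * b] ->
  (forall z, Q x y s z -> `|D0 u z| <= L /\ `|D1 u z| <= L) ->
  L * (s * (a + b)) <= (3 / 2) ^+ n * l ->
  \int[leb]_(t in `[y, y + s * b]) `|D1 u (p1, t)| < l / 16 ->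
  content_le [set z | Q x y s z /\ l < `|u z - u (p1, p2)|]
    ((a + b) / c * s / l ^+ 2 * \int[area]_(z in Q x y s) gradsq u z).
Proof.
move=> Cu; have cG := continuous_gradsq Cu.
have K0 : 0 < (a + b) / c by rewrite divr_gt0// addr_gt0.
elim: n x y s l p1 p2 => [|n IH] x y s l p1 p2 s0 l0 p1I p2J uL Ll D1l.
  (* [n] bounds the remaining depth: at depth 0 the Lipschitz bound alone keeps the oscillation
     within [l]. *)
  have -> : [set z | Q x y s z /\ l < `|u z - u (p1, p2)|] = set0.
    apply/seteqP; split => // z /= [Qz]; apply/negP; rewrite -leNgt.
    apply: le_trans (oscillation_le_lipschitz Cu s0 p1I p2J uL Qz) _.
    by rewrite expr0 mul1r in Ll.
  apply: content_le0; apply: mulr_ge0.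
    by rewrite ltW// divr_gt0 ?exprn_gt0// mulr_gt0.
  by apply: Rintegral_ge0 => z _; exact: gradsq_ge0.
have [big|small] := leP (c * l ^+ 2) (\int[area]_(z in Q x y s) gradsq u z).
  apply: (@content_leS _ _ (ball (x, y) (s * (a + b))) _ (s * (a + b))).
  - by move=> z [Qz _]; exact: rect_sub_ball Qz.
  - rewrite [leLHS](_ : _ = (a + b) / c * s / l ^+ 2 * (c * l ^+ 2)); last first.
      by field; rewrite !gt_eqF.
    by rewrite ler_pM2l// divr_gt0 ?exprn_gt0// mulr_gt0.
  - by apply: content_le_ball; rewrite mulr_ge0 ?addr_ge0// ltW.
have s2 : 0 < s / 2 by rewrite divr_gt0.
have l2 : 0 < 3 / 4 * l by rewrite mulr_gt0.
have quarter x' y' : x <= x' -> x' + s / 2 * a <= x + s * a ->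
    y <= y' -> y' + s / 2 * b <= y + s * b ->
    content_le [set z | Q x' y' (s / 2) z /\ l < `|u z - u (p1, p2)|]
    ((a + b) / c * s / l ^+ 2 * \int[area]_(z in Q x' y' (s / 2)) gradsq u z).
  move=> xx' x'x yy' y'y.
  have QQ : Q x' y' (s / 2) `<=` Q x y s.
    by apply: setSX; apply: subset_itv; rewrite bnd_simp.
  have [p1' [p2' [p1'I p2'J D1p up]]] :=
    good_cross Cu s0 l0 xx' x'x yy' y'y p1I p2J small D1l.
  have uL' z : Q x' y' (s / 2) z -> `|D0 u z| <= L /\ `|D1 u z| <= L.
    by move=> /QQ; exact: uL.
  have Ll' : L * (s / 2 * (a + b)) <= (3 / 2) ^+ n * (3 / 4 * l).
    by apply: half_scale; rewrite exprS in Ll.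
  apply: content_leS (IH x' y' (s / 2) (3 / 4 * l) p1' p2' s2 l2 p1'I p2'J uL' Ll' D1p).
  - move=> z [Qz lz]; split => //=.
    exact: oscillation_step up lz.
  - set I := \int[area]_(z in _) _.
    have I0 : 0 <= I by apply: Rintegral_ge0 => z _; exact: gradsq_ge0.
    (* The coefficient s / l^2 is multiplied by (1/2) / (3/4)^2 = 8/9, so each quarter is charged at
       most its share of the parent's bound. *)
    rewrite [leLHS](_ : _ = 8 / 9 * ((a + b) / c * s / l ^+ 2 * I)); last first.
      by field; rewrite !gt_eqF.
    apply: ler_piMl; last by rewrite ler_pdivrMr// mul1r ler_nat.
    by apply: mulr_ge0 => //; rewrite ltW// divr_gt0 ?exprn_gt0// mulr_gt0.
have [sa2 sb2] : 0 < s / 2 * a /\ 0 < s / 2 * b by rewrite !mulr_gt0.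
have ea : x + s / 2 * a + s / 2 * a = x + s * a by field.
have eb : y + s / 2 * b + s / 2 * b = y + s * b by field.
rewrite rect_quarters// !mulrDr.
apply: content_leS (lexx _) (content_leU
  (content_leU (quarter x y _ _ _ _) (quarter x (y + s / 2 * b) _ _ _ _))
  (content_leU (quarter (x + s / 2 * a) y _ _ _ _)
    (quarter (x + s / 2 * a) (y + s / 2 * b) _ _ _ _))); rewrite ?ea ?eb //.
  move=> [t1 t2] [[/= t1I t2J] lt].
  have t1E : `[x, x + s / 2 * a]%classic t1 \/ `[x + s / 2 * a, x + s * a]%classic t1.
    move: t1I; rewrite /= !in_itv/= => /andP[-> ->]; rewrite andbT.
    by have [/ltW|] := ltP t1 (x + s / 2 * a); [left|right].
  have t2E : `[y, y + s / 2 * b]%classic t2 \/ `[y + s / 2 * b, y + s * b]%classic t2.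
    move: t2J; rewrite /= !in_itv/= => /andP[-> ->]; rewrite andbT.
    by have [/ltW|] := ltP t2 (y + s / 2 * b); [left|right].
  by case: t1E => ?; case: t2E => ?; [left; left|left; right|right; left|right; right].
all: by rewrite -?ea -?eb ?lerDl ltW.
Qed.

End Capacity.

Section CapacityEstimate.
Context {R : realType}.
Variables (a b : R).
Hypotheses (a0 : 0 < a) (b0 : 0 < b).
Implicit Types (u : R * R -> R).
Local Notation leb := (@lebesgue_measure R).
Local Notation D1 u := ('D_(Defs.basis (ord_max : 'I_2)) u).
Local Notation D := (rect 0 a 0 b).

Lemma half_step (x y l : R) : `|y| < l / 2 -> l < `|x| -> l / 2 < `|x - y|.
Proof. by move=> yl lx; have := ler_normD (x - y) y; rewrite subrK; lra. Qed.

(** Bernoulli's inequality: (3/2)^n is at least 1 + n/2. *)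
Lemma exists_expr_ge (x : R) : exists n, x <= (3 / 2) ^+ n.
Proof.
exists (Num.bound (2 * `|x|)); set n := Num.bound _.
have xn : 2 * `|x| < n%:R by exact: archi_boundP.
have {xn} xn : x <= 1 + n%:R / 2 by have := ler_norm x; lra.
apply: le_trans xn _; elim: n => [|n IH]; first by rewrite mul0r addr0.
by rewrite exprS -natr1; have : 0 <= n%:R :> R by []; lra.
Qed.

(** If the squared H^1 norm is large compared with l^2, one ball containing the rectangle is already
    affordable. Otherwise averaging yields a starting point where |u| < l/2, on a vertical line of
    small variation, and where |u| > l the oscillation about that point exceeds l/2, so the
    recursive estimate applies. *)
Lemma content_C1_superlevel : exists2 C, 0 < C & forall u (l : R), C1 u -> 0 < l ->
  content_le [set z | D z /\ l < `|u z|]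
    (C / l ^+ 2 * (\int[area]_(z in D) (u z ^+ 2) + \int[area]_(z in D) gradsq u z)).
Proof.
pose q := 3 * Num.min a b / 128.
have m0 : 0 < Num.min a b by rewrite lt_min a0.
have q0 : 0 < q by rewrite divr_gt0// mulr_gt0.
have qE d : 128 * q <= 3 * d = (Num.min a b <= d).
  by rewrite /q mulrC divfK ?pnatr_eq0// ler_pM2l.
have qa : 128 * q <= 3 * a by rewrite qE ge_min lexx.
have qb : 128 * q <= 3 * b by rewrite qE ge_min lexx orbT.
pose c := q ^+ 2 / (a * b).
have c0 : 0 < c by rewrite divr_gt0 ?exprn_gt0// mulr_gt0.
have cE : q ^+ 2 = c * (a * b) by rewrite divfK// gt_eqF// mulr_gt0.
(* [c'] lies below both [c] and [c * b ^+ 2], so that one threshold serves the gradient and the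
   function divided by [b]. *)
pose c' := c * (b ^+ 2 / (1 + b ^+ 2)).
have b1 : 0 < 1 + b ^+ 2 by rewrite addr_gt0// exprn_gt0.
have c'0 : 0 < c' by rewrite mulr_gt0// divr_gt0// exprn_gt0.
have c'c : c' <= c.
  by rewrite ger_pMr// ler_pdivrMr// mul1r lerDr.
have c'b : c' <= c * b ^+ 2.
  rewrite /c' ler_pM2l// ler_pdivrMr// ler_pMr ?exprn_gt0//.
  by rewrite lerDl sqr_ge0.
have ab0 : 0 < a + b by rewrite addr_gt0.
exists (4 * ((a + b) / c')); first by rewrite mulr_gt0// divr_gt0.
move=> u l Cu l0; have [_ cu] := Cu; have cG := continuous_gradsq Cu.
have cu0 := C1_continuous Cu.
have cn i : continuous (fun z => `|'D_(Defs.basis i) u z|).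
  by move=> z; apply: cvg_norm; exact: cu.
set I := \int[area]_(z in D) gradsq u z; set J := \int[area]_(z in D) _.
have I0 : 0 <= I by apply: Rintegral_ge0 => z _; exact: gradsq_ge0.
have J0 : 0 <= J by apply: Rintegral_ge0 => z _; exact: sqr_ge0.
pose k := l / 2; have k0 : 0 < k by rewrite divr_gt0.
have DE : D = rect 0 (0 + 1 * a) 0 (0 + 1 * b) by rewrite !mul1r !add0r.
have -> : 4 * ((a + b) / c') / l ^+ 2 * (J + I) = (a + b) / c' / k ^+ 2 * (J + I).
  by rewrite /k; field; rewrite !gt_eqF.
have [big|small] := leP (c' * k ^+ 2) (J + I).
  apply: (@content_leS _ _ (ball ((0, 0) : R * R) (a + b)) _ (a + b)).
  - by move=> z [Dz _]; rewrite -[a + b]mul1r; apply: rect_sub_ball => //; rewrite -DE.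
  - rewrite [leLHS](_ : _ = (a + b) / c' / k ^+ 2 * (c' * k ^+ 2)); last first.
      by field; rewrite !gt_eqF.
    by rewrite ler_pM2l// !divr_gt0 ?exprn_gt0.
  - by apply: content_le_ball; exact: ltW.
have Ismall : I < c * k ^+ 2.
  apply: (@le_lt_trans _ _ (J + I)); first by rewrite lerDr.
  by apply: lt_le_trans small _; rewrite ler_pM2r ?exprn_gt0.
have D1s : \int[area]_(z in D) `|D1 u z| < q * k.
  have := @partials_L1_lt R a b a0 b0 q c q0 cE u 0 0 1 k Cu ltr01 k0.
  by rewrite -DE mulr1 => /(_ Ismall)[].
have us : \int[area]_(z in D) `|b^-1 * u z| < q * k.
  rewrite DE -[k]mulr1; apply: (@rect_L1_lt _ a b a0 b0 q c) => //.
    by move=> z; apply: cvgM; [exact: cvg_cst|exact: cu0].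
  rewrite -DE.
  under eq_Rintegral => z _ do rewrite exprMn.
  rewrite RintegralZl//; last 2 first.
  - exact: measurable_rect.
  - by apply: continuous_integrable_rect => z; apply: cvgM; exact: cu0.
  rewrite exprVn ltr_pdivrMl ?exprn_gt0//.
  apply: (@le_lt_trans _ _ (J + I)); first by rewrite lerDl.
  by apply: lt_le_trans small _; rewrite [leRHS]mulrA ler_pM2r ?exprn_gt0// mulrC.
(* Both terms have to be small on the same vertical line, so their sum is averaged. Thanks to the
   factor [b^-1], the integral of the second term along such a line is the mean of |u| on it. *)
pose F z := `|D1 u z| + `|b^-1 * u z|.
have cbu : continuous (fun z => `|b^-1 * u z|).
  by move=> z; apply: cvg_norm; apply: cvgM; [exact: cvg_cst|exact: cu0].
have cF : continuous F by move=> z; apply: cvgD; [exact: cn|exact: cbu].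
have [p1 p1I Fp1] : exists2 t, t \in `[0, a] &
    \int[leb]_(r in `[0, b]) F (t, r) < k / 16.
  apply: exists_section_lt_averagel => //; first exact: ltW.
  rewrite RintegralD//; [|exact: measurable_rect|exact: continuous_integrable_rect..].
  apply: lt_le_trans (ltrD D1s us) _.
  rewrite subr0 (_ : _ * a = 4 * a / 128 * k + 4 * a / 128 * k); last by field.
  by rewrite lerD// ler_pM2r// ler_pdivlMr// mulrC (le_trans qa)// ler_pM2r// ler_nat.
have iD1 : leb.-integrable `[0, b] (EFin \o (fun r => `|D1 u (p1, r)|)).
  apply: continuous_integrable_itv.
  exact: (@continuous_sectionr _ (fun z => `|D1 u z|) p1 (cn _)).
have iu : leb.-integrable `[0, b] (EFin \o (fun r => `|b^-1 * u (p1, r)|)).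
  apply: continuous_integrable_itv.
  exact: (@continuous_sectionr _ (fun z => `|b^-1 * u z|) p1 cbu).
rewrite /F RintegralD// in Fp1.
have D1p : \int[leb]_(r in `[0, b]) `|D1 u (p1, r)| < k / 16.
  by apply: le_lt_trans Fp1; rewrite lerDl; apply: Rintegral_ge0.
have [p2 p2J up] : exists2 t, t \in `[0, b] & `|b^-1 * u (p1, t)| < b^-1 * k.
  apply: (exists_itv_lt_average (ltW b0) iu).
  rewrite subr0 mulrC mulrA divff ?gt_eqF// mul1r.
  apply: (@lt_trans _ _ (k / 16)).
    by apply: le_lt_trans Fp1; rewrite lerDr; apply: Rintegral_ge0.
  by rewrite ltr_pdivrMr// ltr_pMr// ltr1n.
have {}up : `|u (p1, p2)| < k.
  by move: up; rewrite normrM ger0_norm ?invr_ge0 ?ltW// ltr_pM2l// invr_gt0.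
have [L0 L0p HL0] := continuous_bounded_rect 0 a 0 b (cn ord0).
have [L1 L1p HL1] := continuous_bounded_rect 0 a 0 b (cn ord_max).
(* [L] only determines the depth [n] of the recursion and does not enter the resulting bound, so it
   may depend on [u] and be supplied by compactness. *)
pose L := L0 + L1.
have uL z : D z -> `|'D_(Defs.basis (ord0 : 'I_2)) u z| <= L /\ `|D1 u z| <= L.
  move=> Dz; split.
    by have := HL0 _ Dz; rewrite normr_id => /le_trans; apply; rewrite lerDl.
  by have := HL1 _ Dz; rewrite normr_id => /le_trans; apply; rewrite lerDr.
have [n Hn] : exists n, L * (1 * (a + b)) <= (3 / 2) ^+ n * k.
  have [n Hn] := exists_expr_ge (L * (1 * (a + b)) / k).
  by exists n; rewrite -ler_pdivrMr.
apply: (@content_leS _ _ [set z | D z /\ k < `|u z - u (p1, p2)|] _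
  ((a + b) / c * 1 / k ^+ 2 * I)).
- by move=> z [Dz lz]; split => //; exact: half_step up lz.
- rewrite mulr1; apply: ler_pM => //.
  + by apply: divr_ge0; [apply: divr_ge0; exact: ltW|exact: sqr_ge0].
  + by rewrite ler_pM2r ?invr_gt0 ?exprn_gt0// ler_pM2l// lef_pV2.
  + by rewrite lerDr.
- rewrite /I DE; apply: (content_rect_oscillation a0 b0 q0 qa qb c0 cE Cu _ k0 _ _ _ Hn) => //.
  + by rewrite mul1r add0r.
  + by rewrite mul1r add0r.
  + by rewrite -DE.
  + by rewrite mul1r add0r.
Qed.
End CapacityEstimate.

(** * Weak derivatives on a rectangle *)

Section OpenRectangles.
Context {R : realType}.

Definition open_rects : set (set (R * R)) :=
  [set A | exists x1 x2 y1 y2, A = `]x1, x2[%classic `*` `]y1, y2[%classic].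

Lemma in_itv_bound (x : R) : exists n : nat, `](- n%:R), n%:R[%classic x.
Proof.
exists (Num.bound `|x|); rewrite /= in_itv/= -ltr_norml.
exact: archi_boundP.
Qed.

(** Bounded open rectangles form the generating pi-system for the Dynkin argument below, since their
    indicators are limits of C^1 cut-offs. Measurability of the two projections suffices, and an
    open strip is a countable union of bounded rectangles. *)
Lemma measurable_plane_open_rects : @measurable _ (plane R) = <<s open_rects >>.
Proof.
pose P := g_sigma_algebraType open_rects.
have mfst : @measurable_fun _ _ P (measurableTypeR R) setT fst.
  apply: (@measurability _ _ P (measurableTypeR R) setT fst _
    (RGenOpens.measurableE R)) => _ [_ [x1 [x2 ->] <-]].
  rewrite setTI (_ : _ @^-1` _ = \bigcup_n (`]x1, x2[%classic `*` `](- n%:R), n%:R[%classic)).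
    apply: bigcup_measurable => n _; apply: sub_sigma_algebra.
    by exists x1, x2, (- n%:R), n%:R.
  apply/seteqP; split=> [[x y] /= xI|[x y] [n _ []]//].
  by have [n yn] := in_itv_bound y; exists n.
have msnd : @measurable_fun _ _ P (measurableTypeR R) setT snd.
  apply: (@measurability _ _ P (measurableTypeR R) setT snd _
    (RGenOpens.measurableE R)) => _ [_ [y1 [y2 ->] <-]].
  rewrite setTI (_ : _ @^-1` _ = \bigcup_n (`](- n%:R), n%:R[%classic `*` `]y1, y2[%classic)).
    apply: bigcup_measurable => n _; apply: sub_sigma_algebra.
    by exists (- n%:R), n%:R, y1, y2.
  apply/seteqP; split=> [[x y] /= yI|[x y] [n _ []]//].
  by have [n xn] := in_itv_bound x; exists n.
rewrite eqEsubset; split; last first.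
  apply: smallest_sub; first exact: sigma_algebra_measurable.
  by move=> _ [x1 [x2 [y1 [y2 ->]]]]; apply: measurableX; exact: measurable_itv.
rewrite measurable_prod_measurableType; apply: smallest_sub.
  exact: smallest_sigma_algebra.
move=> _ [A mA [B mB <-]].
have -> : A `*` B = (setT `&` fst @^-1` A) `&` (setT `&` snd @^-1` B).
  by rewrite !setTI; apply/seteqP; split.
have mT : @measurable _ P setT by exact: measurableT.
by apply: (@measurableI _ P); [exact: mfst|exact: msnd].
Qed.

Lemma setI_closed_open_rects : setI_closed open_rects.
Proof.
move=> _ _ [x1 [x2 [y1 [y2 ->]]]] [x1' [x2' [y1' [y2' ->]]]].
exists (Num.max x1 x1'), (Num.min x2 x2'), (Num.max y1 y1'), (Num.min y2 y2').
apply/seteqP; split => -[x y]; rewrite /= !in_itv/= !gt_max !lt_min.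
  by move=> [[/andP[-> ->] /andP[-> ->]] [/andP[-> ->] /andP[-> ->]]].
by move=> [/andP[/andP[-> ->] /andP[-> ->]] /andP[/andP[-> ->] /andP[-> ->]]].
Qed.

Lemma interior_rectangle (a b : R) :
  (rectangle a b)° = `]0, a[%classic `*` `]0, b[%classic.
Proof.
apply/seteqP; split.
  move=> [x y] /nbhs_ballP[e /= e0 eD].
  have e2 : 0 < e / 2 by rewrite divr_gt0.
  have : rectangle a b (x + e / 2, y + e / 2).
    apply: eD; split; rewrite /ball/= opprD addNKr normrN ger0_norm ?ltW//;
    by rewrite ltr_pdivrMr// ltr_pMr// ltr1n.
  have : rectangle a b (x - e / 2, y - e / 2).
    apply: eD; split; rewrite /ball/= opprD addNKr opprK ger0_norm ?ltW//;
    by rewrite ltr_pdivrMr// ltr_pMr// ltr1n.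
  rewrite /rectangle/= !in_itv/= => -[/andP[? ?] /andP[? ?]] [/andP[? ?] /andP[? ?]].
  by split; apply/andP; split; lra.
have oo : open (`]0, a[%classic `*` `]0, b[%classic : set (R * R)).
  rewrite openE => -[x y] [/= xI yI].
  exists (`]0, a[%classic, `]0, b[%classic) => //.
  by split; apply: open_nbhs_nbhs; split => //; exact: interval_open.
rewrite -open_subsetE// => -[x y] [/= xI yI].
by split; apply: subset_itv_oo_cc.
Qed.
End OpenRectangles.

(** * Cut-off functions of class C^1 *)

Section SmoothStep.
Context {R : realType}.
Implicit Types (s t : R).

(** The square of the positive part is of class C^1, which is all that [test_function] demands. *)
Definition sqpos t : R := Num.max 0 t ^+ 2.

Lemma is_derive_sqpos t : is_derive t (1 : R) sqpos (2 * Num.max 0 t).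
Proof.
have [t0|t0|->] := ltgtP t 0.
- rewrite mulr0.
  apply: (@near_eq_is_derive R R R (cst (0 : R)) sqpos t 1 0).
  near=> s; rewrite /sqpos (max_idPl _) ?expr0n//.
  by apply: ltW; near: s; exact: lt_nbhsl.
- apply: (@near_eq_is_derive _ _ _ (fun s => s ^+ 2)).
    near=> s; rewrite /sqpos (max_idPr _)//.
    by apply: ltW; near: s; exact: lt_nbhsr.
  have := @is_deriveX _ _ (@id R) 2 t 1 1 (is_derive_id _ _).
  by rewrite /= expr1 scaler1.
- rewrite mulr0.
  have H : (fun h : R => h^-1 *: ((sqpos \o shift 0) (h *: (1 : R)) - sqpos 0)) @ 0^' --> (0 : R).
    have -> : (fun h : R => h^-1 *: ((sqpos \o shift 0) (h *: (1 : R)) - sqpos 0)) =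
        (fun h => Num.max 0 h).
      apply/funext => h; rewrite /sqpos/= addr0 maxxx expr0n subr0 /GRing.scale/= mulr1.
      have [h0|h0] := leP h 0.
        by rewrite expr0n mulr0.
      by rewrite expr2 mulrA mulVf ?mul1r// gt_eqF.
    have cm : (fun h : R => Num.max 0 h) h @[h --> (0 : R)] --> (Num.max 0 0 : R).
      by apply: (@continuous_max _ _ (cst 0) id); [exact: cvg_cst|exact: cvg_id].
    by rewrite maxxx in cm; exact: cvg_within_filter cm.
  split; first by apply/cvg_ex; exists 0.
  exact: cvg_lim.
Unshelve. all: by end_near. Qed.

(** The usual quotient that rises from 0 to 1 on the unit interval; its denominator is positive
    because [t] and [1 - t] are never both nonpositive. *)
Definition step t : R := sqpos t / (sqpos t + sqpos (1 - t)).

Lemma sqpos_ge0 t : 0 <= sqpos t. Proof. exact: sqr_ge0. Qed.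

Lemma step_den_gt0 t : 0 < sqpos t + sqpos (1 - t).
Proof.
have [t0|t0] := leP t 0; last first.
  apply: ltr_wpDr; first exact: sqpos_ge0.
  by rewrite /sqpos (max_idPr (ltW t0)) exprn_gt0.
apply: ltr_wpDl; first exact: sqpos_ge0.
by rewrite /sqpos (max_idPr _) ?exprn_gt0//; lra.
Qed.

Lemma step_le0 t : t <= 0 -> step t = 0.
Proof. by move=> t0; rewrite /step /sqpos (max_idPl t0) expr0n mul0r. Qed.

Lemma step_ge1 t : 1 <= t -> step t = 1.
Proof.
move=> t1; have := step_den_gt0 t; rewrite /step.
have -> : sqpos (1 - t) = 0 by rewrite /sqpos (max_idPl _) ?expr0n// subr_le0.
by rewrite addr0 => t0; rewrite divff// gt_eqF.
Qed.

Lemma step_bound t : 0 <= step t <= 1.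
Proof.
rewrite /step divr_ge0 ?sqpos_ge0 ?addr_ge0 ?sqpos_ge0//=.
by rewrite ler_pdivrMr ?step_den_gt0// mul1r lerDl sqpos_ge0.
Qed.

(** The derivative is left in the shape produced by the product and inverse rules. *)
Definition step' t : R :=
  sqpos t * (- (sqpos t + sqpos (1 - t)) ^- 2 *
    (2 * Num.max 0 t + 2 * Num.max 0 (1 - t) * -1)) +
  (sqpos t + sqpos (1 - t))^-1 * (2 * Num.max 0 t).

Lemma is_derive_step t : is_derive t (1 : R) step (step' t).
Proof.
have d1 := is_derive_sqpos t.
have d2 : is_derive t (1 : R) (sqpos \o (fun s => 1 - s)) (2 * Num.max 0 (1 - t) * -1).
  apply: is_derive1_comp; first exact: is_derive_sqpos.
  have H : is_derive t (1 : R) (cst (1 : R) - id) (0 - 1) by apply: is_deriveB.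
  by rewrite sub0r in H.
have ne : (sqpos + (sqpos \o (fun s => 1 - s))) t != 0.
  by rewrite gt_eqF//; exact: step_den_gt0.
exact: is_deriveM d1 (is_deriveV ne (is_deriveD d1 d2)).
Qed.

Lemma continuous_step' : continuous step'.
Proof.
have cm : continuous (fun t : R => Num.max 0 t).
  by move=> t; apply: continuous_max; [exact: cvg_cst|exact: cvg_id].
have c1 : continuous (fun t : R => 1 - t).
  by move=> t; apply: cvgB; [exact: cvg_cst|exact: cvg_id].
have cs : continuous sqpos by move=> t; apply: cvgM; exact: cm.
have cm1 : continuous (fun t => Num.max 0 (1 - t)).
  by move=> t; apply: (@continuous_comp _ _ _ (fun t => 1 - t)); [exact: c1|exact: cm].
have cs1 : continuous (fun t => sqpos (1 - t)).
  by move=> t; apply: (@continuous_comp _ _ _ (fun t => 1 - t)); [exact: c1|exact: cs].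
have cd : continuous (fun t => sqpos t + sqpos (1 - t)).
  by move=> t; apply: cvgD; [exact: cs|exact: cs1].
have dn0 t : sqpos t + sqpos (1 - t) != 0 by rewrite gt_eqF// step_den_gt0.
have ci : continuous (fun t => (sqpos t + sqpos (1 - t))^-1).
  by move=> t; apply: cvgV; [exact: dn0|exact: cd].
have ci2 : continuous (fun t => (sqpos t + sqpos (1 - t)) ^- 2).
  move=> t; apply: cvgV; first by rewrite expf_neq0.
  by apply: cvgM; exact: cd.
move=> t; apply: cvgD; apply: cvgM.
- exact: cs.
- apply: cvgM; first by apply: cvgN; exact: ci2.
  apply: cvgD; first by apply: cvgM; [exact: cvg_cst|exact: cm].
  by apply: cvgM; [apply: cvgM; [exact: cvg_cst|exact: cm1]|exact: cvg_cst].
- exact: ci.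
- by apply: cvgM; [exact: cvg_cst|exact: cm].
Qed.

End SmoothStep.

Section Bump.
Context {R : realType}.

Lemma differentiable_coord (i : 'I_2) (z : R * R) : differentiable (Defs.coord i) z.
Proof.
rewrite /Defs.coord; case: (i == ord0).
  by apply: (@linear_differentiable R (R * R)%type R fst) => x; exact: cvg_fst.
by apply: (@linear_differentiable R (R * R)%type R snd) => x; exact: cvg_snd.
Qed.

Lemma C1_comp_coord (f f' : R -> R) (i : 'I_2) (k m : R) : continuous f' ->
  (forall t, is_derive t (1 : R) f (f' t)) ->
  C1 (fun z : R * R => f (k * Defs.coord i z + m)).
Proof.
move=> cf' df.
pose l z := k * Defs.coord i z + m.
have dl z : differentiable l z.
  by apply: differentiableD => //; apply: differentiableM => //; exact: differentiable_coord.
have dF t : differentiable f t by apply/derivable1_diffP; have [] := df t.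
have cl : continuous l by move=> z; exact: differentiable_continuous.
split=> [z|v]; first exact: (@differentiable_comp _ _ _ _ l f).
have -> : 'D_v (fun z => f (k * Defs.coord i z + m)) = (fun z => k * Defs.coord i v * f' (l z)).
  apply/funext => z.
  have -> : 'D_v (fun z => f (k * Defs.coord i z + m)) z = 'D_(k * Defs.coord i v) f (l z).
    suff E : (fun h : R => h^-1 *: (((fun z => f (k * Defs.coord i z + m)) \o shift z) (h *: v)
        - f (k * Defs.coord i z + m))) =
        (fun h : R => h^-1 *: ((f \o shift (l z)) (h *: (k * Defs.coord i v)) - f (l z))).
      by rewrite /derive E.
    apply/funext => h /=; congr (_ *: (f _ - _)); rewrite /l /Defs.coord /GRing.scale/=.
    by case: (i == ord0) => /=; rewrite /GRing.scale/=; ring.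
  rewrite deriveE// diff1E//= derive1E; congr (_ * _).
  by have [_] := df (l z).
move=> z; apply: cvgM; first exact: cvg_cst.
by apply: (@continuous_comp _ _ _ l f'); [exact: cl|exact: cf'].
Qed.

(* [step (n t - 1)] vanishes for [t <= 1 / n] and is [1] for [t >= 2 / n]. *)
Definition bump (x1 x2 y1 y2 : R) (n : nat) (z : R * R) : R :=
  step (n%:R * (z.1 - x1) - 1) * step (n%:R * (x2 - z.1) - 1) *
  (step (n%:R * (z.2 - y1) - 1) * step (n%:R * (y2 - z.2) - 1)).

Lemma C1_bump (x1 x2 y1 y2 : R) n : C1 (bump x1 x2 y1 y2 n).
Proof.
have C i (k m : R) : C1 (fun z : R * R => step (k * Defs.coord i z + m)).
  by apply: C1_comp_coord; [exact: continuous_step'|exact: is_derive_step].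
have -> : bump x1 x2 y1 y2 n = (fun z =>
    (step (n%:R * Defs.coord ord0 z + (- n%:R * x1 - 1)) *
     step (- n%:R * Defs.coord ord0 z + (n%:R * x2 - 1))) *
    (step (n%:R * Defs.coord ord_max z + (- n%:R * y1 - 1)) *
     step (- n%:R * Defs.coord ord_max z + (n%:R * y2 - 1)))).
  apply/funext => z; rewrite /bump /Defs.coord /=.
  by congr (step _ * step _ * (step _ * step _)); ring.
apply: C1_mul; apply: C1_mul; exact: C.
Qed.

Lemma bump_neq0 (x1 x2 y1 y2 : R) n z : bump x1 x2 y1 y2 n.+1 z != 0 ->
  rect (x1 + n.+1%:R^-1) (x2 - n.+1%:R^-1) (y1 + n.+1%:R^-1) (y2 - n.+1%:R^-1) z.
Proof.
case: z => x y.
have H4 (p q r s : R) : p * q * (r * s) != 0 -> [/\ p != 0, q != 0, r != 0 & s != 0].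
  by rewrite !mulf_eq0 !negb_or => /andP[/andP[-> ->] /andP[-> ->]].
move=> /H4[h1 h2 h3 h4].
have H (t : R) : step (n.+1%:R * t - 1) != 0 -> n.+1%:R^-1 <= t.
  apply: contra_neqT; rewrite -ltNge => tn; apply: step_le0.
  rewrite subr_le0; apply: ltW; move: tn.
  by rewrite -[X in _ < X -> _]mulr1 ltr_pdivlMl// mulrC.
apply/in_rect; move: (H _ h1) (H _ h2) (H _ h3) (H _ h4).
by move: n.+1%:R^-1 => e /= ? ? ? ?; split; lra.
Qed.

Lemma bump_bound (x1 x2 y1 y2 : R) n z : 0 <= bump x1 x2 y1 y2 n z <= 1.
Proof.
have H (s t : R) : 0 <= s <= 1 -> 0 <= t <= 1 -> 0 <= s * t <= 1.
  by move=> /andP[? ?] /andP[? ?]; rewrite mulr_ge0//= mulr_ile1.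
by rewrite /bump; apply: (H); apply: (H); exact: step_bound.
Qed.

(** The number [t] is positive exactly inside the open rectangle. There all four factors equal 1 as
    soon as n t >= 2; elsewhere some factor vanishes for every n. The sequence is thus eventually
    constant at each point. *)
Lemma cvg_bump (x1 x2 y1 y2 : R) z :
  bump x1 x2 y1 y2 n z @[n --> \oo] -->
  (\1_(`]x1, x2[%classic `*` `]y1, y2[%classic) z : R).
Proof.
case: z => x y; pose t := Num.min (Num.min (x - x1) (x2 - x)) (Num.min (y - y1) (y2 - y)).
have H n (r : R) : 2 <= n%:R * t -> t <= r -> step (n%:R * r - 1) = 1.
  move=> nt tr; apply: step_ge1.
  have : n%:R * t <= n%:R * r by rewrite ler_wpM2l.
  by lra.
have tE : t <= x - x1 /\ t <= x2 - x /\ t <= y - y1 /\ t <= y2 - y.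
  by rewrite /t !ge_min !lexx !orbT.
have [t0|t0] := ltP 0 t.
  have -> : \1_(`]x1, x2[%classic `*` `]y1, y2[%classic) (x, y) = 1 :> R.
    rewrite indicE mem_set//=.
    by move: t0; rewrite /t !lt_min !subr_gt0 !in_itv/= => /andP[/andP[-> ->] /andP[-> ->]].
  apply: cvg_near_cst.
  near=> n.
  have nt : 2 <= n%:R * t.
    rewrite -ler_pdivrMr//; near: n; exact: nbhs_infty_ger.
  case: tE => [? [? [? ?]]].
  by rewrite /bump/= !H// !mulr1.
have -> : \1_(`]x1, x2[%classic `*` `]y1, y2[%classic) (x, y) = 0 :> R.
  rewrite indicE memNset//= !in_itv/= => -[/andP[? ?] /andP[? ?]].
  move: t0; rewrite leNgt /t !lt_min !subr_gt0; apply/negP; rewrite negbK.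
  by apply/andP; split; apply/andP.
apply: cvg_near_cst; near=> n.
have H0 (r : R) : r <= 0 -> step (n%:R * r - 1) = 0.
  move=> r0; apply: step_le0; rewrite subr_le0.
  by apply: (@le_trans _ _ 0) => //; exact: mulr_ge0_le0.
move: t0; rewrite /t /bump/= !ge_min => /orP[/orP[]|/orP[]] /H0 ->; by rewrite ?(mul0r, mulr0).
Unshelve. all: by end_near. Qed.
End Bump.

Lemma sumr_I2 {R : realType} (F : 'I_2 -> R) : \sum_(i < 2) F i = F ord0 + F ord_max.
Proof.
by rewrite big_ord_recl big_ord1 (_ : lift ord0 ord0 = ord_max)//; exact: val_inj.
Qed.

Lemma Rintegral_eq0 d (T : measurableType d) (R : realType)
    (mu : {measure set T -> \bar R}) (D : set T) (f : T -> R) :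
  (forall z, D z -> f z = 0) -> \int[mu]_(z in D) f z = 0.
Proof. by move=> f0; rewrite /Rintegral integral0_eq// => z /f0 ->. Qed.

Lemma sqr_add_le (R : realType) (s t : R) : (s + t) ^+ 2 <= 2 * (s ^+ 2 + t ^+ 2).
Proof. by have := sqr_ge0 (s - t); nra. Qed.

(** * Integration by parts and closedness of the weak derivative *)

Section WeakPartials.
Context {R : realType}.
Variables (a b : R).
Implicit Types (u v p q : R * R -> R) (i : 'I_2).
Local Notation D := (rectangle a b).
Local Notation leb := (@lebesgue_measure R).
Local Notation sq f := (\int[area]_(z in D) (f z ^+ 2)).

Lemma measurable_rectangle : @measurable _ (plane R) D.
Proof. exact: measurable_rect. Qed.

Local Notation mD := measurable_rectangle.
#[local] Hint Resolve measurable_rectangle : core.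

Lemma L2_continuous u : continuous u -> L2 D u.
Proof. by move=> cu; apply: continuous_L2 => //; exists 0, a, 0, b. Qed.

Lemma I2_cases i : i = ord0 \/ i = ord_max.
Proof. by case: i => -[|[|//]] ?; [left|right]; exact: val_inj. Qed.

Lemma test_function_C1 phi : test_function D° phi -> C1 phi.
Proof. by case. Qed.

Lemma test_function_eq0 phi z : test_function D° phi -> ~ D° z -> phi z = 0.
Proof. by move=> [_ [C [_ CD Cphi]]] Dz; apply: Cphi => /CD. Qed.

(** Integrating first in the variable of differentiation turns each section integral into a
    difference of values on two opposite edges, where [u] vanishes. *)
Lemma Rintegral_partial_eq0 u i : 0 <= a -> 0 <= b -> C1 u -> (forall z, ~ D° z -> u z = 0) ->
  \int[area]_(z in D) 'D_(Defs.basis i) u z = 0.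
Proof.
move=> a0 b0 Cu u0; have [_ cu] := Cu.
have {}u0 z : ~ (`]0, a[%classic `*` `]0, b[%classic) z -> u z = 0.
  by rewrite -interior_rectangle; exact: u0.
have [->|->] := I2_cases i.
  have [_ ->] := fubini_rectr 0 a 0 b (cu (Defs.basis ord0)).
  apply: Rintegral_eq0 => y _; rewrite C1_FTCl// !u0 ?subrr//= => -[]; rewrite /= !in_itv/=.
    by rewrite ltxx.
  by rewrite ltxx andbF.
have [_ ->] := fubini_rectl 0 a 0 b (cu (Defs.basis ord_max)).
apply: Rintegral_eq0 => x _; rewrite C1_FTCr// !u0 ?subrr//= => -[]; rewrite /= !in_itv/=.
  by rewrite ltxx.
by rewrite ltxx andbF.
Qed.

Lemma C1_weak_partial u i : 0 <= a -> 0 <= b -> C1 u ->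
  weak_partial D i u ('D_(Defs.basis i) u).
Proof.
move=> a0 b0 Cu; have [_ cu] := Cu; split; first exact: L2_continuous.
move=> phi tphi; have Cphi := test_function_C1 tphi; have [_ cphi] := Cphi.
have Lu := L2_continuous (C1_continuous Cu).
have Lp := L2_continuous (C1_continuous Cphi).
apply/eqP; rewrite -addr_eq0 -RintegralD//; last 2 first.
- by apply: L2_integrable_mul => //; exact: L2_continuous.
- by apply: L2_integrable_mul => //; exact: L2_continuous.
apply/eqP; rewrite -(@Rintegral_partial_eq0 (fun z => u z * phi z) i a0 b0).
- by apply: eq_Rintegral => z _; rewrite derive_mul// [X in _ + X = _]mulrC.
- exact: C1_mul.
- by move=> z Dz; rewrite (test_function_eq0 tphi Dz) mulr0.
Qed.

Lemma weak_partial_lin u v p q i (k l : R) : L2 D u -> L2 D v ->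
  weak_partial D i u p -> weak_partial D i v q ->
  weak_partial D i (fun z => k * u z + l * v z) (fun z => k * p z + l * q z).
Proof.
move=> Lu Lv [Lp up] [Lq vq]; split; first exact: L2_lin.
move=> phi tphi; have Cphi := test_function_C1 tphi; have [_ cphi] := Cphi.
have Lphi := L2_continuous (C1_continuous Cphi).
have Ldphi := L2_continuous (cphi (Defs.basis i)).
have E f g h : L2 D f -> L2 D g -> L2 D h ->
    \int[area]_(z in D) ((k * f z + l * g z) * h z) =
    k * \int[area]_(z in D) (f z * h z) + l * \int[area]_(z in D) (g z * h z).
  move=> Lf Lg Lh; rewrite -Rintegral_lin2//; try exact: L2_integrable_mul.
  by apply: eq_Rintegral => z _; ring.
by rewrite !E// up// vq//; ring.
Qed.

(** The graph of the weak derivative is closed in L^2. Since [v] and [q] satisfy the defining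
    identity, its defect [X + Y] for [u] and [p] is a sum of two pairings with [u - v] and [p - q],
    small by Cauchy-Schwarz. *)
Lemma weak_partial_approx u p i : L2 D u -> L2 D p ->
  (forall e, 0 < e -> exists v q, [/\ L2 D v, weak_partial D i v q,
    sq (fun z => u z - v z) <= e & sq (fun z => p z - q z) <= e]) ->
  weak_partial D i u p.
Proof.
move=> Lu Lp H; split=> // phi tphi; have Cphi := test_function_C1 tphi.
have [_ cphi] := Cphi.
have Lphi := L2_continuous (C1_continuous Cphi).
have Ldphi := L2_continuous (cphi (Defs.basis i)).
set dphi := 'D_(Defs.basis i) phi in Ldphi *.
set X := \int[area]_(z in D) (u z * dphi z); set Y := \int[area]_(z in D) (p z * phi z).
apply/eqP; rewrite -addr_eq0 -[_ == 0](sqrf_eq0 (X + Y)) eq_le sqr_ge0 andbT.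
apply/ler_addgt0Pr => e e0; rewrite add0r.
(* The summand 1 makes [S] positive, and the final bound becomes e (S - 1) / S, which is at most
   e. *)
pose S := 2 * (sq dphi + sq phi) + 1.
have S0 : 0 < S.
  by rewrite ltr_wpDl// mulr_ge0// addr_ge0// sqr_integral_ge0.
have [v [q [Lv [Lq vq] uv pq]]] := H (e / S) (divr_gt0 e0 S0).
have B f g h : L2 D f -> L2 D g -> L2 D h ->
    \int[area]_(z in D) ((f z - g z) * h z) =
    \int[area]_(z in D) (f z * h z) - \int[area]_(z in D) (g z * h z).
  move=> Lf Lg Lh; rewrite -RintegralB//; try exact: L2_integrable_mul.
  by apply: eq_Rintegral => z _; ring.
have L2B f g : L2 D f -> L2 D g -> L2 D (fun z => f z - g z).
  move=> Lf Lg; have := L2_lin mD 1 (-1) Lf Lg.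
  by congr L2; apply/funext => z; ring.
have XE : X + Y = \int[area]_(z in D) ((u z - v z) * dphi z) +
    \int[area]_(z in D) ((p z - q z) * phi z).
  rewrite !B// -/X -/Y (vq _ tphi); ring.
have c1 := L2_cauchy_schwarz mD (L2B _ _ Lu Lv) Ldphi.
have c2 := L2_cauchy_schwarz mD (L2B _ _ Lp Lq) Lphi.
have {}c1 := le_trans c1 (ler_wpM2r (sqr_integral_ge0 D dphi) uv).
have {}c2 := le_trans c2 (ler_wpM2r (sqr_integral_ge0 D phi) pq).
rewrite XE; apply: le_trans (sqr_add_le _ _) _.
apply: (@le_trans _ _ (2 * (e / S * sq dphi + e / S * sq phi))).
  by rewrite ler_pM2l// lerD.
rewrite (_ : 2 * _ = e * ((S - 1) / S)); last by rewrite /S; field; rewrite gt_eqF.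
by rewrite ger_pMr// ler_pdivrMr// mul1r gerBl.
Qed.

End WeakPartials.

(** * The fundamental lemma of the calculus of variations *)

Section WeakPartialUnique.
Context {R : realType}.
Variables (a b : R).
Hypotheses (a0 : 0 < a) (b0 : 0 < b).
Implicit Types (d u p q : R * R -> R) (i : 'I_2).
Local Notation D := (rectangle a b).
Local Notation leb := (@lebesgue_measure R).
Local Notation sq f := (\int[area]_(z in D) (f z ^+ 2)).
#[local] Hint Resolve measurable_rectangle : core.

Lemma measurable_interior_rectangle : @measurable _ (plane R) D°.
Proof. by apply: open_measurable_plane; exact: open_interior. Qed.
#[local] Hint Resolve measurable_interior_rectangle : core.

Lemma area_rectangle_boundary : area (D `\` D°) = 0%E.
Proof.
have mi := measurable_interior_rectangle.
rewrite measureD//; last exact: area_rect_lty.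
rewrite setIC setIidl; last exact: interior_subset.
change (area D - area D° = 0)%E.
have -> : area D° = (leb `]0%R, a[%classic * leb `]0%R, b[%classic)%E.
  by rewrite interior_rectangle; apply: areaX; exact: measurable_itv.
have -> : area D = (leb `[0%R, a]%classic * leb `[0%R, b]%classic)%E.
  by apply: areaX; exact: measurable_itv.
have E (x : R) : 0 < x -> leb `]0, x[%classic = leb `[0, x]%classic.
  by move=> x0; rewrite !lebesgue_measure_itv.
by rewrite !E// subee// lebesgue_itvcc ?ltW// lebesgue_itvcc ?ltW.
Qed.

Lemma L2_integrable d : L2 D d -> area.-integrable D (EFin \o d).
Proof.
move=> Ld; have L1 : L2 D (fun=> 1) by apply: L2_continuous; exact: cst_continuous.
have := L2_integrable_mul (measurable_rectangle a b) Ld L1.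
by congr (area.-integrable _ _); apply/funext => z /=; rewrite mulr1.
Qed.

Lemma test_function_bump x1 x2 y1 y2 n : 0 <= x1 -> x2 <= a -> 0 <= y1 -> y2 <= b ->
  test_function D° (bump x1 x2 y1 y2 n.+1).
Proof.
move=> x10 x2a y10 y2b; split; first exact: C1_bump.
exists (rect (x1 + n.+1%:R^-1) (x2 - n.+1%:R^-1) (y1 + n.+1%:R^-1) (y2 - n.+1%:R^-1)).
split; first exact: compact_rect.
  have : 0 < n.+1%:R^-1 :> R by rewrite invr_gt0.
  rewrite interior_rectangle; move: n.+1%:R^-1 => e e0 [x y] /in_rect[? ? ? ?].
  by split; rewrite /= in_itv/=; apply/andP; split; lra.
move=> z nz; apply/eqP; apply: contra_notT nz; exact: bump_neq0.
Qed.

(** Clipping the rectangle to the interior of the domain makes its bumps admissible as test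
    functions; dominated convergence, with |d| as majorant, replaces them by the indicator. *)
Lemma orthogonal_open_rect d x1 x2 y1 y2 : L2 D d ->
  (forall phi, test_function D° phi -> \int[area]_(z in D) (d z * phi z) = 0) ->
  (\int[area]_(z in D° `&` (`]x1, x2[%classic `*` `]y1, y2[%classic)) (d z)%:E = 0)%E.
Proof.
move=> Ld dphi.
pose X1 := Num.max 0 x1; pose X2 := Num.min a x2.
pose Y1 := Num.max 0 y1; pose Y2 := Num.min b y2.
have -> : D° `&` (`]x1, x2[%classic `*` `]y1, y2[%classic) =
    `]X1, X2[%classic `*` `]Y1, Y2[%classic.
  rewrite interior_rectangle; apply/seteqP; split => -[x y]; rewrite /= !in_itv/= !gt_max !lt_min.
    by move=> [[/andP[-> ->] /andP[-> ->]] [/andP[-> ->] /andP[-> ->]]].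
  by move=> [/andP[/andP[-> ->] /andP[-> ->]] /andP[/andP[-> ->] /andP[-> ->]]].
set B := _ `*` _.
have mB : @measurable _ (plane R) B by apply: measurableX; exact: measurable_itv.
have BD : B `<=` D.
  move=> [x y] [/=]; rewrite !in_itv/= !gt_max !lt_min.
  move=> /andP[/andP[? ?] /andP[? ?]] /andP[/andP[? ?] /andP[? ?]].
  by split; rewrite /= in_itv/=; apply/andP; split; apply: ltW.
have iB n : \int[area]_(z in D) (d z * bump X1 X2 Y1 Y2 n.+1 z) = 0.
  apply: dphi; apply: test_function_bump; by rewrite ?le_max ?ge_min lexx.
have iE n : area.-integrable D (EFin \o (fun z => d z * bump X1 X2 Y1 Y2 n.+1 z)).
  by apply: L2_integrable_mul => //; apply: L2_continuous; exact/C1_continuous/C1_bump.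
have id := L2_integrable Ld.
have := @dominated_convergence _ (plane R) R area D (measurable_rectangle a b)
  (fun n z => (d z * bump X1 X2 Y1 Y2 n.+1 z)%:E) (fun z => (d z * \1_B z)%:E)
  (fun z => (`|d z|)%:E).
case.
- by move=> n; exact: measurable_int (iE n).
- apply/measurable_EFinP; apply: measurable_funM; first exact: L2_measurable Ld.
  exact: measurable_indic.
- apply: aeW => z Dz; apply: cvg_EFin; first exact: nearW.
  apply: cvgM; first exact: cvg_cst.
  have := @cvg_bump R X1 X2 Y1 Y2 z.
  by rewrite -(cvg_shiftS (fun n => bump X1 X2 Y1 Y2 n z)).
- exact: integrable_norm.
- apply: aeW => z n Dz; rewrite /= lee_fin normrM ler_piMr//.
  by have /andP[? ?] := bump_bound X1 X2 Y1 Y2 n.+1 z; rewrite ger0_norm.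
move=> _ _.
have -> : [sequence (\int[area]_(z in D) (d z * bump X1 X2 Y1 Y2 n.+1 z)%:E)%E]_n = cst 0%E.
  apply/funext => n /=.
  have := integrable_fin_num (measurable_rectangle a b) (iE n).
  by move=> /fineK <-; congr EFin; exact: iB.
move=> /(cvg_unique (@ereal_hausdorff R) (cvg_cst _)) H; rewrite [RHS]H.
have -> : (\int[area]_(z in B) (d z)%:E = \int[area]_(z in D `&` B) (d z)%:E)%E.
  by rewrite setIC setIidl.
rewrite integral_mkcondr; apply: eq_integral => z _.
by rewrite patchE indicE; case: ifPn => _; rewrite ?mulr1 ?mulr0.
Qed.

(** The sets over which [d] has zero integral form a Dynkin system that contains the open
    rectangles, hence all measurable sets, so [d] vanishes almost everywhere. *)
Lemma orthogonal_ae0 d : L2 D d ->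
  (forall phi, test_function D° phi -> \int[area]_(z in D) (d z * phi z) = 0) ->
  ae_eq area D (EFin \o d) (cst 0%E).
Proof.
move=> Ld dphi.
have id := L2_integrable Ld.
have idi : area.-integrable D° (EFin \o d).
  by apply: integrableS id => //; exact: interior_subset.
have iS A : @measurable _ (plane R) A -> area.-integrable (D° `&` A) (EFin \o d).
  by move=> mA; apply: integrableS idi => //; exact: measurableI.
have H : forall A, @measurable _ (plane R) A -> (\int[area]_(z in D° `&` A) (d z)%:E = 0)%E.
  move=> A; rewrite measurable_plane_open_rects.
  have T0 : (\int[area]_(z in D°) (d z)%:E = 0)%E.
    rewrite -[D°]setIid [X in _ `&` X]interior_rectangle.
    exact: orthogonal_open_rect.
  apply: (@dynkin_induction _ (plane R) open_rects
    (fun A => \int[area]_(z in D° `&` A) (d z)%:E = 0)%E).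
  - exact: measurable_plane_open_rects.
  - exact: setI_closed_open_rects.
  - by rewrite setIT.
  - by move=> _ [x1 [x2 [y1 [y2 ->]]]]; exact: orthogonal_open_rect.
  - move=> S mS S0.
    have := @integral_setU _ (plane R) R area (D° `&` S) (D° `&` ~` S) (EFin \o d).
    rewrite -setIUr setUCr setIT T0 S0 add0e => <- //.
    + exact: measurableI.
    + by apply: measurableI => //; exact: measurableC.
    + exact: measurable_int idi.
    + by apply/disj_setPS => z [[_ ?] [_ ?]].
  - move=> F mF tF F0.
    rewrite setI_bigcupr integral_bigcup//.
    + by rewrite eseries0// => n _ _; exact: F0.
    + by apply: trivIset_setIl.
    + by move=> n; exact: measurableI.
    + rewrite -setI_bigcupr; apply: iS; exact: bigcupT_measurable.
have Hi : ae_eq area D° (EFin \o d) (cst 0%E).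
  apply: integral_ae_eq => // E ED mE.
  by rewrite integral0 -[RHS](H E mE) setIidr.
(* Test functions see the interior only; the edges have zero area, which carries the conclusion over
   to the closed rectangle. *)
have N : {ae area, forall z, ~ (D `\` D°) z}.
  exists (D `\` D°); split; [exact: measurableD|exact: area_rectangle_boundary|].
  by move=> z /= /contrapT.
apply: filterS2 Hi N => z Hz Nz Dz; apply: Hz; apply: contrapT => nDz.
by apply: Nz; split.
Qed.

(** Equality of the squared norms is what makes the Dirichlet integral and the H^1 norm independent
    of the choice made in [wpartial]. *)
Lemma weak_partial_unique u p q i : weak_partial D i u p -> weak_partial D i u q ->
  sq p = sq q.
Proof.
move=> [Lp up] [Lq uq].
have Ld := L2_lin (measurable_rectangle a b) 1 (-1) Lp Lq.
have /(_ _)/= H := @orthogonal_ae0 _ Ld.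
have {}H : ae_eq area D (EFin \o (fun z => 1 * p z + -1 * q z)) (cst 0%E).
  apply: H => phi tphi.
  have Lphi : L2 D phi by apply: L2_continuous; exact/C1_continuous/(test_function_C1 tphi).
  have -> : \int[area]_(z in D) ((1 * p z + -1 * q z) * phi z) =
      \int[area]_(z in D) (1 * (p z * phi z) + -1 * (q z * phi z)).
    by apply: eq_Rintegral => z _; ring.
  rewrite Rintegral_lin2//; try exact: L2_integrable_mul.
  have := up _ tphi; rewrite uq// => /eqP; rewrite eqr_opp => /eqP ->; ring.
congr fine; apply: ge0_ae_eq_integral => //.
- exact: measurable_rectangle.
- by apply: measurable_int (L2_integrable_sqr Lp).
- by apply: measurable_int (L2_integrable_sqr Lq).
- by move=> z _; rewrite lee_fin sqr_ge0.
- by move=> z _; rewrite lee_fin sqr_ge0.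
- move: H; apply: filterS => z H Dz; have [/eqP] := H Dz.
  by rewrite mul1r mulN1r subr_eq0 => /eqP ->.
Qed.

End WeakPartialUnique.

(** * The Dirichlet integral and the H^1 norm as quadratic forms *)

Section Sobolev.
Context {R : realType}.
Variables (a b : R).
Hypotheses (a0 : 0 < a) (b0 : 0 < b).
Implicit Types (u v p q h : R * R -> R) (i : 'I_2).
Local Notation D := (rectangle a b).
Local Notation sq f := (\int[area]_(z in D) (f z ^+ 2)).
#[local] Hint Resolve measurable_rectangle : core.

Lemma wpartialP u i : H1 D u -> weak_partial D i u (wpartial D i u).
Proof.
move=> [_ /(_ i) [p up]].
by have := @xgetPex _ (fun=> 0) [set p | weak_partial D i u p] (ex_intro _ p up).
Qed.

(** As a choice, [wpartial] need not be linear. Under the integral of a square, however, any weak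
    derivative may stand in for it, in particular the combination of the chosen ones. *)
Lemma sq_wpartial u p i : weak_partial D i u p -> sq (wpartial D i u) = sq p.
Proof.
move=> up; apply: (weak_partial_unique a0 b0 (u := u) (i := i)) => //.
by have := @xgetPex _ (fun=> 0) [set p | weak_partial D i u p] (ex_intro _ p up).
Qed.

Definition dirichlet u : R := \sum_(i < 2) sq (wpartial D i u).

Definition H1sq u : R := sq u + dirichlet u.

Lemma dirichlet_ge0 u : 0 <= dirichlet u.
Proof. by apply: sumr_ge0 => i _; exact: sqr_integral_ge0. Qed.

Lemma H1sq_ge0 u : 0 <= H1sq u.
Proof. by rewrite addr_ge0// ?dirichlet_ge0// sqr_integral_ge0. Qed.

Lemma H1normE u : H1norm D u = Num.sqrt (H1sq u). Proof. by []. Qed.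

Lemma H1_L2 u : H1 D u -> L2 D u. Proof. by case. Qed.

Lemma wpartial_L2 u i : H1 D u -> L2 D (wpartial D i u).
Proof. by move=> /(wpartialP i)[]. Qed.

Lemma H1_lin u v (k l : R) : H1 D u -> H1 D v -> H1 D (fun z => k * u z + l * v z).
Proof.
move=> Hu Hv; have [Lu Lv] := (H1_L2 Hu, H1_L2 Hv); split; first exact: L2_lin.
move=> i; exists (fun z => k * wpartial D i u z + l * wpartial D i v z).
by apply: weak_partial_lin => //; exact: wpartialP.
Qed.

Lemma sq_wpartial_lin u v (k l : R) i : H1 D u -> H1 D v ->
  sq (wpartial D i (fun z => k * u z + l * v z)) =
  sq (fun z => k * wpartial D i u z + l * wpartial D i v z).
Proof.
move=> Hu Hv; apply: sq_wpartial; apply: weak_partial_lin; try exact: wpartialP.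
- exact: H1_L2.
- exact: H1_L2.
Qed.

Lemma C1_H1 u : C1 u -> H1 D u.
Proof.
move=> Cu; split; first exact/L2_continuous/C1_continuous.
by move=> i; exists ('D_(Defs.basis i) u); apply: C1_weak_partial => //; exact: ltW.
Qed.

Lemma sq_wpartial_C1 u i : C1 u -> sq (wpartial D i u) = sq ('D_(Defs.basis i) u).
Proof. by move=> Cu; apply: sq_wpartial; apply: C1_weak_partial => //; exact: ltW. Qed.

Lemma dirichlet_C1 u : C1 u -> dirichlet u = \int[area]_(z in D) gradsq u z.
Proof.
move=> Cu; have [_ cu] := Cu.
have ci i : area.-integrable D (EFin \o (fun z => 'D_(Defs.basis i) u z ^+ 2)).
  by apply: continuous_integrable_rect => z; apply: cvgM; exact: cu.
rewrite /dirichlet (eq_bigr _ (fun i _ => sq_wpartial_C1 i Cu)) sumr_I2.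
exact: esym (RintegralD (measurable_rectangle a b) (ci ord0) (ci ord_max)).
Qed.

Definition dirichlet_form u v : R :=
  \sum_(i < 2) \int[area]_(z in D) (wpartial D i u z * wpartial D i v z).

Lemma dirichlet_lin u v (k l : R) : H1 D u -> H1 D v ->
  dirichlet (fun z => k * u z + l * v z) =
  k ^+ 2 * dirichlet u + l ^+ 2 * dirichlet v + 2 * k * l * dirichlet_form u v.
Proof.
move=> Hu Hv; rewrite /dirichlet /dirichlet_form !mulr_sumr -!big_split/=.
apply: eq_bigr => i _; rewrite sq_wpartial_lin//.
exact: (L2_sqr_lin (measurable_rectangle a b) k l (wpartial_L2 i Hu) (wpartial_L2 i Hv)).
Qed.

Lemma H1sq_lin u v (k l : R) : H1 D u -> H1 D v ->
  H1sq (fun z => k * u z + l * v z) = k ^+ 2 * H1sq u + l ^+ 2 * H1sq v +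
  2 * k * l * (\int[area]_(z in D) (u z * v z) + dirichlet_form u v).
Proof.
move=> Hu Hv; rewrite /H1sq (dirichlet_lin k l Hu Hv).
rewrite (L2_sqr_lin (measurable_rectangle a b) k l (H1_L2 Hu) (H1_L2 Hv)).
move: (sq u) (sq v) (\int[area]_(z in D) (u z * v z)) (dirichlet u) (dirichlet v)
  (dirichlet_form u v) => x1 x2 x3 x4 x5 x6; ring.
Qed.

(** Adding the nonnegative value at k u - l v cancels the cross term. *)
Lemma H1sq_lin_le u v (k l : R) : H1 D u -> H1 D v ->
  H1sq (fun z => k * u z + l * v z) <= 2 * k ^+ 2 * H1sq u + 2 * l ^+ 2 * H1sq v.
Proof.
move=> Hu Hv; have := H1sq_ge0 (fun z => k * u z + (- l) * v z).
rewrite (H1sq_lin k l Hu Hv) (H1sq_lin k (- l) Hu Hv).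
move: (H1sq u) (H1sq v) (_ + dirichlet_form u v) => x y z; rewrite sqrrN => H.
have -> : 2 * k ^+ 2 * x + 2 * l ^+ 2 * y = k ^+ 2 * x + l ^+ 2 * y +
  2 * k * l * z + (k ^+ 2 * x + l ^+ 2 * y + 2 * k * - l * z) by ring.
by rewrite lerDl.
Qed.

Lemma dirichlet_lin_le u v (k l : R) : H1 D u -> H1 D v ->
  dirichlet (fun z => k * u z + l * v z) <= 2 * k ^+ 2 * dirichlet u + 2 * l ^+ 2 * dirichlet v.
Proof.
move=> Hu Hv; have := dirichlet_ge0 (fun z => k * u z + (- l) * v z).
rewrite (dirichlet_lin k l Hu Hv) (dirichlet_lin k (- l) Hu Hv).
move: (dirichlet u) (dirichlet v) (dirichlet_form u v) => x y z; rewrite sqrrN => H.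
have -> : 2 * k ^+ 2 * x + 2 * l ^+ 2 * y = k ^+ 2 * x + l ^+ 2 * y +
  2 * k * l * z + (k ^+ 2 * x + l ^+ 2 * y + 2 * k * - l * z) by ring.
by rewrite lerDl.
Qed.

Lemma H1sq_sub_le u v w : H1 D u -> H1 D v -> H1 D w ->
  H1sq (u \- w) <= 2 * H1sq (u \- v) + 2 * H1sq (v \- w).
Proof.
move=> Hu Hv Hw.
have sE f g : f \- g = (fun z => 1 * f z + -1 * g z) :> (R * R -> R).
  by apply/funext => z /=; ring.
have Huv : H1 D (u \- v) by rewrite sE; exact: H1_lin.
have Hvw : H1 D (v \- w) by rewrite sE; exact: H1_lin.
have := H1sq_lin_le 1 1 Huv Hvw; rewrite expr1n !mulr1.
have <- : u \- w = (fun z => 1 * (u \- v) z + 1 * (v \- w) z) by apply/funext => z /=; ring.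
by [].
Qed.

Lemma H1sqC u v : H1 D u -> H1 D v -> H1sq (u \- v) = H1sq (v \- u).
Proof.
move=> Hu Hv.
have -> : u \- v = (fun z => 1 * u z + -1 * v z) by apply/funext => z /=; ring.
have -> : v \- u = (fun z => -1 * u z + 1 * v z) by apply/funext => z /=; ring.
rewrite (H1sq_lin 1 (-1) Hu Hv) (H1sq_lin (-1) 1 Hu Hv).
move: (H1sq u) (H1sq v) (_ + dirichlet_form u v) => x y z; ring.
Qed.

Lemma H1norm_cvg0 (f : nat -> R * R -> R) :
  (fun n => H1norm D (f n)) @ \oo --> (0 : R) <-> (fun n => H1sq (f n)) @ \oo --> (0 : R).
Proof.
split=> H.
  have -> : (fun n => H1sq (f n)) = (fun n => H1norm D (f n) * H1norm D (f n)).
    by apply/funext => n; rewrite H1normE -expr2 sqr_sqrtr// H1sq_ge0.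
  by rewrite -(mulr0 0); exact: cvgM.
have S := @sqrt_continuous R (0 : R); rewrite /continuous_at sqrtr0 in S.
exact: (cvg_comp _ _ H S).
Qed.
End Sobolev.

(** * Traces and the Poincare inequality *)

Lemma cvg_lin0 (R : realType) (c d : R) (x y : nat -> R) :
  x @ \oo --> (0 : R) -> y @ \oo --> (0 : R) ->
  (fun n => c * x n + d * y n) @ \oo --> (0 : R).
Proof.
move=> x0 y0.
have L : (fun n => c * x n + d * y n) @ \oo --> (c * 0 + d * 0 : R).
  by apply: cvgD; apply: cvgM => //; exact: cvg_cst.
by rewrite !mulr0 addr0 in L.
Qed.

Lemma half_powD (R : realType) n m :
  1 / 2 ^+ (n + m.+1).+1 = 1 / 2 ^+ m.+1 / 2 ^+ n.+1 :> R.
Proof. by rewrite -addSn exprD !div1r invfM mulrC. Qed.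

Lemma double_add_le (R : realType) (x y t : R) : x <= t -> y <= t ->
  2 * x + 2 * y <= 4 * t.
Proof. by move=> xt yt; lra. Qed.

Section Trace.
Context {R : realType}.
Variables (a b : R).
Hypotheses (a0 : 0 < a) (b0 : 0 < b).
Implicit Types (u v h : R * R -> R) (S : set (R * R)).
Local Notation D := (rectangle a b).
Local Notation H1sq := (H1sq a b).

Lemma H1_sub u v : H1 D u -> H1 D v -> H1 D (u \- v).
Proof.
move=> Hu Hv; have -> : u \- v = (fun z => 1 * u z + -1 * v z).
  by apply/funext => z /=; ring.
exact: H1_lin.
Qed.

(** An equivalent of [has_trace] with one function per tolerance, which does not mention sequences
    or exceptional null sets and is therefore easy to pass to the limit. *)
Definition trace_approx u S h := forall e : R, 0 < e ->
  exists v, [/\ C1 v, H1sq (v \- u) <= e &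
    content_le [set z | S z /\ e < `|v z - h z|] e].

Lemma sum_half_le (e : R) n : 0 <= e -> \sum_(0 <= k < n) (e / 2 ^+ k.+1) <= e.
Proof.
move=> e0; suff -> : \sum_(0 <= k < n) (e / 2 ^+ k.+1) = e - e / 2 ^+ n.
  by rewrite gerBl divr_ge0// exprn_ge0.
elim: n => [|n IH]; first by rewrite big_geq// expr0 divr1 subrr.
by rewrite big_nat_recr//= IH exprS; field; rewrite expf_neq0.
Qed.

(** Partial sums of the thresholds are monotone and dominate each threshold; adding [k] makes the
    indices tend to infinity. *)
Lemma exists_fast_indices (d : nat -> R) (x : nat -> R) : (forall k, 0 < d k) ->
  x @ \oo --> (0 : R) ->
  exists f : nat -> nat, [/\ forall k, (k <= f k)%N, forall k, (f k <= f k.+1)%N &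
    forall k m, (f k <= m)%N -> x m <= d k].
Proof.
move=> d0 x0.
have /choice[f Hf] : forall k, exists N, forall m, (N <= m)%N -> x m <= d k.
  move=> k; have /cvgr0Pnorm_le /(_ _ (d0 k)) [N _ HN] := x0.
  by exists N => m Nm; apply: le_trans (ler_norm _) _; exact: HN.
exists (fun k => \sum_(j < k.+1) f j + k)%N; split.
- by move=> k; rewrite leq_addl.
- by move=> k; rewrite [in leqRHS]big_ord_recr/= leq_add// leq_addr.
- move=> k m km; apply: Hf; apply: leq_trans km.
  by rewrite big_ord_recr/= addnAC leq_addl.
Qed.

(* A rapidly convergent subsequence converges uniformly off a set of small
   content, by the estimate for superlevel sets of C^1 functions. *)
Lemma has_trace_approx u S h : H1 D u -> S `<=` D -> has_trace D u S h ->
  trace_approx u S h.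
Proof.
move=> Hu SD [v [Cv vu [N [N0 vh]]]] e e0.
have [C C0 HC] := content_C1_superlevel a0 b0.
have e2 : 0 < e / 2 by rewrite divr_gt0.
(* These tolerances add up to [e / 2]; the other half of [e] covers the exceptional set [N]. *)
pose ek k := e / 2 / 2 ^+ k.+1.
have ek0 k : 0 < ek k by rewrite divr_gt0// exprn_gt0.
(* The cube compensates the factor C / ek^2 of the capacity estimate and leaves ek; the 4 absorbs
   the constants of the triangle inequality for squares. The minimum with [e] takes care of
   [w 0]. *)
pose dk k := Num.min e (ek k ^+ 3 / (4 * C)).
have dk0 k : 0 < dk k by rewrite lt_min e0 divr_gt0 ?exprn_gt0// mulr_gt0.
have vu0 : (fun n => H1sq (v n \- u)) @ \oo --> (0 : R) by apply/H1norm_cvg0.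
have [f [kf ff fd]] := exists_fast_indices dk0 vu0.
pose w k := v (f k).
have Hw k : H1 D (w k) by exact: (C1_H1 a0 b0 (Cv _)).
have Hww k : H1sq (w k.+1 \- w k) <= ek k ^+ 3 / C.
  have K1 := H1sq_sub_le a0 b0 (Hw k.+1) Hu (Hw k).
  rewrite (H1sqC a0 b0 Hu (Hw k)) in K1.
  have K2 : H1sq (w k.+1 \- u) <= ek k ^+ 3 / (4 * C).
    by apply: le_trans (fd k _ (ff k)) _; rewrite ge_min lexx orbT.
  have K3 : H1sq (w k \- u) <= ek k ^+ 3 / (4 * C).
    by apply: le_trans (fd k _ (leqnn _)) _; rewrite ge_min lexx orbT.
  apply: le_trans K1 (le_trans (double_add_le K2 K3) _).
  by rewrite le_eqVlt; apply/orP; left; apply/eqP; move: (ek k) => t; field; rewrite gt_eqF.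
pose E k := [set z | D z /\ ek k < `|w k.+1 z - w k z|].
have cE k : content_le (E k) (ek k).
  have Cw : C1 (w k.+1 \- w k).
    have -> : w k.+1 \- w k = (fun z => 1 * w k.+1 z + -1 * w k z).
      by apply/funext => z /=; ring.
    by apply: C1_lin; exact: Cv.
  apply: content_leS (HC _ (ek k) Cw (ek0 k)) => //.
  have := Hww k; rewrite /H1sq dirichlet_C1//.
  move: (_ + _) => x xk.
  by rewrite mulrAC ler_pdivrMr ?exprn_gt0// mulrC -ler_pdivlMr.
exists (w 0%N); split; first exact: Cv.
  by apply: le_trans (fd 0%N _ (leqnn _)) _; rewrite ge_min lexx.
rewrite [X in content_le _ X](splitr e).
apply: content_leS (lexx _) (content_leU (N0 _ e2)
  (content_le_bigcup cE (half_series (ltW e2)))).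
move=> x [Sx ex]; have [Nx|Nx] := pselect (N x); [by left|right].
apply: contrapT => nE.
have step k : `|w k.+1 x - w k x| <= ek k.
  rewrite leNgt; apply/negP => H; apply: nE; exists k => //; split => //; exact: SD.
have wk k : `|w k x - w 0%N x| <= e / 2.
  apply: le_trans (sum_half_le k (ltW e2)).
  elim: k => [|k IH]; first by rewrite subrr normr0 big_geq.
  rewrite big_nat_recr//= -(subrKA (w k x)) addrC.
  by apply: le_trans (ler_normD _ _) _; rewrite lerD// step.
have /cvgrPdist_le /(_ _ e2) [M _ HM] := vh x Sx Nx.
have := HM (f M) (kf M); move: (wk M); rewrite /w => K1 K2.
have := ler_distD (v (f M) x) (w 0%N x) (h x).
rewrite distrC in K1; rewrite distrC in K2; move: ex K1 K2; rewrite /w.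
by move: (`| _ |) (`| _ |) (`| _ |) => x1 x2 x3; lra.
Qed.

(** A Borel-Cantelli argument for the content: with tolerances 1 / 2^(n+1), the points that lie in
    infinitely many bad sets form a null set, and elsewhere the error is eventually below the
    tolerance. *)
Lemma approx_has_trace u S h : H1 D u -> trace_approx u S h -> has_trace D u S h.
Proof.
move=> Hu H.
pose e n : R := 1 / 2 ^+ n.+1.
have e0 n : 0 < e n by rewrite divr_gt0// exprn_gt0.
have e_cvg : e n @[n --> \oo] --> (0 : R).
  have -> : e = geometric 2^-1 2^-1.
    by apply/funext => n; rewrite /e /geometric/= div1r -exprVn exprS.
  by apply: cvg_geometric; rewrite ger0_norm ?invr_ge0// invf_lt1// ltr1n.
have /choice[v Hv] : forall n, exists v, [/\ C1 v, H1sq (v \- u) <= e n &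
    content_le [set z | S z /\ e n < `|v z - h z|] (e n)].
  by move=> n; exact: H.
exists v; split.
- by move=> n; have [] := Hv n.
- apply/H1norm_cvg0; apply: (@squeeze_cvgr _ _ _ _ (cst 0) e) => //.
    by apply: nearW => n; rewrite H1sq_ge0/=; have [] := Hv n.
  exact: cvg_cst.
pose B n := [set z | S z /\ e n < `|v n z - h z|].
exists (\bigcap_m \bigcup_n B (n + m)%N); split.
- move=> d d0.
  have /cvgr0Pnorm_le /(_ _ d0) [m _ Hm] := e_cvg.
  (* The tail is taken from [m.+1] on because its tolerances add up to exactly [e m]. *)
  apply: (@content_leS _ _ (\bigcup_n B (n + m.+1)%N) _ (e m)).
  + by move=> z; exact.
  + by apply: le_trans (ler_norm _) _; exact: (Hm m (leqnn m)).
  + apply: (@content_le_bigcup _ _ (fun n => e m / 2 ^+ n.+1)).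
      move=> n; have [_ _] := Hv (n + m.+1)%N.
      apply: content_leS => //; rewrite /e le_eqVlt; apply/orP; left; apply/eqP.
      exact: half_powD.
    by apply: half_series; exact: ltW.
- move=> x Sx nNx.
  have [m Hm] : exists m, forall n, ~ B (n + m)%N x.
    apply: contrapT => nm; apply: nNx => m _; apply: contrapT => nB; apply: nm; exists m => n Bn.
    by apply: nB; exists n.
  apply/cvgrPdist_le => d d0.
  have /cvgr0Pnorm_le /(_ _ d0) [m' _ Hm'] := e_cvg.
  near=> n.
  have nm : (m <= n)%N by near: n; exact: nbhs_infty_ge.
  have nm' : (m' <= n)%N by near: n; exact: nbhs_infty_ge.
  apply: le_trans (Hm' n nm'); rewrite [leRHS]ger0_norm ?(ltW (e0 n))// leNgt.
  apply/negP => en; apply: (Hm (n - m)%N); rewrite subnK//; split=> //.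
  by rewrite distrC.
Unshelve. all: by end_near. Qed.

(** The bad set depends on the approximant alone, so an approximant of a nearby [v] serves [u] too.
    The tolerance [e / 4] offsets the factors 2 in [H1sq_sub_le]. *)
Lemma trace_approx_closed u S h : H1 D u ->
  (forall e : R, 0 < e -> exists v,
    [/\ H1 D v, trace_approx v S h & H1sq (v \- u) <= e]) ->
  trace_approx u S h.
Proof.
move=> Hu H e e0.
have e4 : 0 < e / 4 by rewrite divr_gt0.
have [v [Hv vS vu]] := H _ e4.
have [w [Cw wv wS]] := vS _ e4.
exists w; split=> //.
  apply: le_trans (H1sq_sub_le a0 b0 (C1_H1 a0 b0 Cw) Hv Hu) _.
  move: wv vu; move: (H1sq _) (H1sq _) => x y; lra.
have ee : e / 4 <= e by rewrite ler_pdivrMr// ler_pMr// ler1n.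
apply: content_leS wS => // z [Sz ez]; split => //.
exact: le_lt_trans ez.
Qed.

Lemma has_trace_lin u u' S h h' (k l : R) : H1 D u -> H1 D u' ->
  has_trace D u S h -> has_trace D u' S h' ->
  has_trace D (fun z => k * u z + l * u' z) S (fun z => k * h z + l * h' z).
Proof.
move=> Hu Hu' [v [Cv vu [N [N0 vh]]]] [v' [Cv' vu' [N' [N'0 vh']]]].
exists (fun n z => k * v n z + l * v' n z); split.
- by move=> n; exact: C1_lin.
- apply/H1norm_cvg0; move/H1norm_cvg0 : vu => vu; move/H1norm_cvg0 : vu' => vu'.
  apply: (@squeeze_cvgr _ _ _ _ (cst 0)
    (fun n => 2 * k ^+ 2 * H1sq (v n \- u) + 2 * l ^+ 2 * H1sq (v' n \- u'))).
  + apply: nearW => n; rewrite H1sq_ge0/=.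
    have -> : (fun z => k * v n z + l * v' n z) \- (fun z => k * u z + l * u' z) =
        (fun z => k * (v n \- u) z + l * (v' n \- u') z).
      by apply/funext => z /=; ring.
    apply: H1sq_lin_le => //; apply: H1_sub => //; exact: (C1_H1 a0 b0).
  + exact: cvg_cst.
  + exact: cvg_lin0.
- exists (N `|` N'); split; first exact: hausdorff1_nullU.
  move=> x Sx NN; apply: cvgD; apply: cvgM; [exact: cvg_cst| |exact: cvg_cst|].
    by apply: vh => // Nx; apply: NN; left.
  by apply: vh' => // Nx; apply: NN; right.
Qed.

End Trace.

Lemma cvg_expr_inv (R : realType) (C x : R) : 1 < x ->
  (fun k => C / x ^+ k) @ \oo --> (0 : R).
Proof.
move=> x1; have -> : (fun k => C / x ^+ k) = geometric C x^-1.
  by apply/funext => k; rewrite /geometric/= exprVn.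
have x0 : 0 < x by exact: lt_trans x1.
by apply: cvg_geometric; rewrite ger0_norm ?invr_ge0 ?(ltW x0)// invf_lt1.
Qed.

(** * The Poincare inequality from the bottom edge *)

Section Poincare.
Context {R : realType}.
Variables (a b : R).
Hypotheses (a0 : 0 < a) (b0 : 0 < b).
Implicit Types (u v h : R * R -> R) (S N : set (R * R)).
Local Notation D := (rectangle a b).
Local Notation H1sq := (H1sq a b).
Local Notation leb := (@lebesgue_measure R).
Local Notation D1 u := ('D_(Defs.basis (ord_max : 'I_2)) u).
#[local] Hint Resolve measurable_rectangle : core.

(** A ball of radius r casts a vertical strip of area 2 b r over the rectangle, so coverings of
    small total radius bound the area of the columns standing on the null set. *)
Lemma hausdorff1_null_column_cover N (e : R) : hausdorff1_null N -> 0 < e ->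
  exists A : set (R * R), [/\ @measurable _ (plane R) A, (area A <= e%:E)%E &
    [set z | D z /\ N (z.1, 0)] `<=` A].
Proof.
move=> N0 e0; have e1 : 0 < e / (2 * b) by rewrite divr_gt0// mulr_gt0.
have [c [r [r0 Ncr re]]] := N0 _ e1.
pose B k : set (R * R) := `[(c k).1 - r k, (c k).1 + r k]%classic `*` `[0, b]%classic.
have mB k : @measurable _ (plane R) (B k) by apply: measurableX; exact: measurable_itv.
have aB k : area (B k) = (2 * b * r k)%:E.
  have -> : B k = rect ((c k).1 - r k) ((c k).1 + r k) 0 b by [].
  rewrite area_rect; [|by have := r0 k; lra|exact: ltW].
  by congr EFin; ring.
exists (\bigcup_k B k); split.
- exact: bigcupT_measurable.
- apply: (@le_trans _ _ (\sum_(0 <= k <oo) area (B k))%E).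
    by apply: measure_sigma_subadditive => //; exact: bigcupT_measurable.
  rewrite (eq_eseriesr (fun k _ => aB k)).
  under eq_eseriesr do rewrite EFinM.
  rewrite nneseriesZl; last by move=> k _; rewrite lee_fin.
  apply: (@le_trans _ _ ((2 * b)%:E * (e / (2 * b))%:E)%E).
    by apply: lee_wpmul2l => //; rewrite lee_fin mulr_ge0// ltW.
  by rewrite -EFinM lee_fin mulrC divfK// gt_eqF// mulr_gt0.
- move=> [x y] [[/= xI yI] Nx]; have [k _ [/= + _]] := Ncr _ Nx.
  rewrite /ball/= ltr_norml => /andP[l1 l2]; exists k => //; split => //=.
  by rewrite in_itv/=; apply/andP; split; lra.
Qed.

Lemma hausdorff1_null_column_negligible N : hausdorff1_null N ->
  {ae area, forall z, D z -> ~ N (z.1, 0)}.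
Proof.
move=> N0.
have /choice[A HA] : forall n : nat, exists A : set (R * R), [/\ @measurable _ (plane R) A,
    (area A <= (n.+1%:R^-1)%:E)%E & [set z | D z /\ N (z.1, 0)] `<=` A].
  by move=> n; apply: hausdorff1_null_column_cover => //; rewrite invr_gt0.
have mA : @measurable _ (plane R) (\bigcap_n A n).
  by apply: bigcapT_measurable => n; have [] := HA n.
exists (\bigcap_n A n); split => //.
- apply/eqP; rewrite eq_le measure_ge0 andbT; apply/lee_addgt0Pr => e e0; rewrite add0e.
  pose n := Num.bound e^-1.
  apply: (@le_trans _ _ (area (A n))).
    by apply: le_measure; rewrite ?inE//; [have [] := HA n|exact: bigcap_inf].
  have [_ + _] := HA n; move=> /le_trans; apply; rewrite lee_fin.
  rewrite -[leRHS]invrK lef_pV2 ?posrE ?invr_gt0//.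
  have : e^-1 < n%:R by apply: archi_boundP; rewrite invr_ge0 ltW.
  by move=> /ltW /le_trans; apply; rewrite ler_nat.
- move=> z /= Hz n _; have [_ _] := HA n; apply.
  by apply: contrapT => nz; apply: Hz => Dz Nz; apply: nz.
Qed.

Lemma sqr_increment_le v x y : C1 v -> y \in `[0, b] ->
  (v (x, y) - v (x, 0)) ^+ 2 <= b * \int[leb]_(t in `[0, b]) (D1 v (x, t) ^+ 2).
Proof.
move=> Cv yb; have [_ cv] := Cv.
have c1 : continuous (fun t => D1 v (x, t)) by exact: (@continuous_sectionr _ (D1 v) x (cv _)).
have cn : continuous (fun t => `|D1 v (x, t)|) by move=> t; apply: cvg_norm; exact: c1.
have c2 : continuous (fun t => D1 v (x, t) ^+ 2) by move=> t; apply: cvgM; exact: c1.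
have := @cauchy_schwarz _ _ R leb `[0, b]%classic (measurable_itv _)
  (fun t => `|D1 v (x, t)|) (fun=> 1).
have -> : (fun t => `|D1 v (x, t)| ^+ 2) = (fun t => D1 v (x, t) ^+ 2).
  by apply/funext => t; rewrite real_normK ?num_real.
have -> : (fun t => `|D1 v (x, t)| * 1) = (fun t => `|D1 v (x, t)|).
  by apply/funext => t; rewrite mulr1.
have E1 : \int[leb]_(_ in `[0, b]) (1 ^+ 2 : R) = b.
  by rewrite Rintegral_cst_itv; [rewrite expr1n mul1r subr0|exact: ltW].
move=> CS; have {}CS := CS (continuous_integrable_itv _ _ c2)
  (continuous_integrable_itv _ _ (@cst_continuous _ _ _)) (continuous_integrable_itv _ _ cn).
apply: (le_trans _ (le_trans CS _)); last by rewrite E1 mulrC.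
rewrite -(real_normK (num_real (_ - _))) ler_pXn2r ?nnegrE//; last first.
  exact: Rintegral_ge0.
by apply: C1_oscillationr => //; rewrite in_itv/= lexx ltW.
Qed.

Lemma sq_increment_le v : C1 v ->
  \int[area]_(z in D) ((v z - v (z.1, 0)) ^+ 2) <= b ^+ 2 * dirichlet a b v.
Proof.
move=> Cv; have [_ cv] := Cv; have cv0 := C1_continuous Cv.
have c0 : continuous (fun z : R * R => v (z.1, 0)).
  move=> z; apply: (@continuous_comp _ _ _ (fun z : R * R => z.1) (fun x => v (x, 0))).
    exact: cvg_fst.
  exact: continuous_sectionl.
have cF : continuous (fun z : R * R => (v z - v (z.1, 0)) ^+ 2).
  by move=> z; apply: cvgM; apply: cvgB; [exact: cv0|exact: c0|exact: cv0|exact: c0].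
have c2 : continuous (fun z => D1 v z ^+ 2) by move=> z; apply: cvgM; exact: cv.
apply: (@le_trans _ _ (b ^+ 2 * \int[area]_(z in D) (D1 v z ^+ 2))); last first.
  rewrite ler_pM2l ?exprn_gt0// dirichlet_C1//.
  apply: le_Rintegral => //.
  - exact: continuous_integrable_rect.
  - by apply: continuous_integrable_rect; exact: continuous_gradsq.
  - by move=> z _; rewrite lerDr sqr_ge0.
have [i1 ->] := fubini_rectl 0 a 0 b cF; have [i2 ->] := fubini_rectl 0 a 0 b c2.
rewrite -RintegralZl//; apply: le_Rintegral => //.
  by apply: (integrableZl _ (b ^+ 2) i2).
move=> x _.
have := @Rintegral_itv_le_cst _ (fun y => (v (x, y) - v (x, 0)) ^+ 2)
  (b * \int[leb]_(t in `[0, b]) (D1 v (x, t) ^+ 2)) 0 b.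
have E (I : R) : b * I * (b - 0) = b ^+ 2 * I by ring.
rewrite E; apply; [|exact: ltW|].
  exact: (@continuous_sectionr _ (fun z => (v z - v (z.1, 0)) ^+ 2) x cF).
by move=> t tb; exact: sqr_increment_le.
Qed.

(** The approximants need not vanish on the bottom edge; their values there merely tend to 0 off a
    null set, hence on almost every column. The inequality is therefore applied to the increments
    from the bottom edge, which converge to [u] almost everywhere, and Fatou's lemma concludes. *)
Lemma poincare u S : H1 D u -> (forall x, 0 <= x <= a -> S (x, 0)) ->
  has_trace D u S (fun=> 0) ->
  \int[area]_(z in D) (u z ^+ 2) <= 2 * b ^+ 2 * dirichlet a b u.
Proof.
move=> Hu bottom [v [Cv vu [N [N0 v0]]]].
have vu0 : (fun n => H1sq (v n \- u)) @ \oo --> (0 : R) by apply/H1norm_cvg0.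
have d0 k : 0 < 1 / 8 ^+ k :> R by rewrite divr_gt0// exprn_gt0.
have [f [kf _ fd]] := exists_fast_indices d0 vu0.
pose w k := v (f k).
have wu k : H1sq (w k \- u) <= 1 / 8 ^+ k by apply: fd.
have Hw k : H1 D (w k) by exact: (C1_H1 a0 b0 (Cv _)).
have cw k : continuous (w k) by exact/C1_continuous/Cv.
have Lwu k : L2 D (w k \- u) by exact/H1_L2/H1_sub.
have wu_ae : {ae area, forall z, D z -> w k z @[k --> \oo] --> u z}.
  have := @ae_geometric_bound _ (plane R) R area D (measurable_rectangle a b)
    (fun k => w k \- u) 1 ler01 (fun k => L2_measurable (Lwu k))
    (fun k => L2_integrable_sqr (Lwu k)).
  have wk k : \int[area]_(z in D) ((w k \- u) z ^+ 2) <= 1 / 8 ^+ k.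
    by apply: le_trans (wu k); rewrite lerDl dirichlet_ge0.
  move=> /(_ wk); apply: filterS => z H Dz; have [C C0 HC] := H Dz.
  apply/cvgrPdist_le => e e0.
  have /cvgr0Pnorm_le /(_ _ e0)[M _ HM] := cvg_expr_inv C (ltr1n R 2).
  exists M => // k /= Mk; rewrite distrC; apply: le_trans (HC k) _.
  by apply: le_trans (ler_norm _) _; exact: HM.
have w0_ae : {ae area, forall z, D z -> w k (z.1, 0) @[k --> \oo] --> 0}.
  apply: (negligibleS _ (hausdorff1_null_column_negligible N0)) => -[x y] /= nz H.
  apply: nz => Dz.
  have Sx : S (x, 0) by apply: bottom; case: Dz; rewrite /= in_itv.
  have := v0 _ Sx (H Dz).
  move=> /cvgrPdist_le vx; apply/cvgrPdist_le => e e0; have [M _ HM] := vx e e0.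
  by exists M => // k /= Mk; apply: HM => /=; apply: leq_trans (kf k).
have c0 k : continuous (fun z : R * R => w k (z.1, 0)).
  move=> z; apply: (@continuous_comp _ _ _ (fun z : R * R => z.1) (fun x => w k (x, 0))).
    exact: cvg_fst.
  by apply: continuous_sectionl; exact: cw.
have cwk k : continuous (fun z : R * R => w k z - w k (z.1, 0)).
  by move=> z; apply: cvgB; [exact: cw|exact: c0].
(* This crude bound is the origin of the factor 2 in the conclusion; the error term disappears as
   the sequence is started at ever larger [K]. *)
have dw k : dirichlet a b (w k) <= 2 * dirichlet a b u + 2 / 8 ^+ k.
  have E : w k = (fun z => 1 * u z + 1 * (w k \- u) z) by apply/funext => z /=; ring.
  rewrite E.
  apply: le_trans (dirichlet_lin_le a0 b0 1 1 Hu (H1_sub (Hw k) Hu)) _.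
  rewrite expr1n !mulr1 lerD2l ler_pM2l// -div1r.
  by apply: le_trans (wu k); rewrite lerDr sqr_integral_ge0.
have bound K : \int[area]_(z in D) (u z ^+ 2) <= b ^+ 2 * (2 * dirichlet a b u + 2 / 8 ^+ K).
  apply: (@fatou_sqr _ (plane R) R area D (measurable_rectangle a b)
    (fun k z => w (k + K)%N z - w (k + K)%N (z.1, 0)) u _ _ _ _ _ _).2.
  - by move=> k; apply: continuous_measurable_plane => //; exact: cwk.
  - exact: (L2_measurable (H1_L2 Hu)).
  - by move=> k; apply: L2_integrable_sqr; apply: L2_continuous; exact: cwk.
  - move=> k; apply: le_trans (sq_increment_le (Cv _)) _; rewrite ler_pM2l ?exprn_gt0//.
    apply: le_trans (dw (k + K)%N) _; rewrite lerD2l ler_pM2l//.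
    by rewrite lef_pV2 ?posrE ?exprn_gt0// ler_eXn2l ?ltr1n// leq_addl.
  - apply: (negligibleS _ (negligibleU wu_ae w0_ae)) => z /= nz.
    apply: contrapT => /not_orP[/contrapT h1 /contrapT h2]; apply: nz => Dz.
    rewrite -[X in _ --> X]subr0; apply: cvgB.
      by rewrite (cvg_shiftn K (fun k => w k z)); exact: h1.
    by rewrite (cvg_shiftn K (fun k => w k (z.1, 0))); exact: h2.
apply/ler_addgt0Pr => e e0.
have e2 : 0 < e / (2 * b ^+ 2) by rewrite divr_gt0// mulr_gt0// exprn_gt0.
have /cvgr0Pnorm_le /(_ _ e2)[K _ HK] := cvg_expr_inv 1 (ltr1n R 8).
have {}HK := le_trans (ler_norm _) (HK K (leqnn K)).
apply: le_trans (bound K) _; move: HK (dirichlet a b u) => HK G.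
rewrite mulrDr mulrA [b ^+ 2 * 2]mulrC lerD2l.
move: HK; rewrite ler_pdivlMr ?mulr_gt0 ?exprn_gt0//.
move: (8 ^+ K)^-1 => t; rewrite mul1r.
by have -> : b ^+ 2 * (2 * t) = t * (2 * b ^+ 2) by ring.
Qed.
End Poincare.

(** * Existence and uniqueness of the minimizer *)

(* Parallelogram law, with [x], [y] the energies of [f], [u] and [t] their
   product: [2 f - u] has energy at least [m] and [f - u] at most [e / 4]. *)
Lemma parallelogram_bound (R : realType) (x y t m d e : R) :
  m <= 2 ^+ 2 * x + (-1) ^+ 2 * y + 2 * 2 * -1 * t ->
  1 ^+ 2 * x + (-1) ^+ 2 * y + 2 * 1 * -1 * t <= e / 4 ->
  x <= m + d -> d <= e / 4 -> y <= m + e.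
Proof. by move=> *; lra. Qed.

Section ScalarProblem.
Context {R : realType}.
Variables (a b : R).
Hypotheses (a0 : 0 < a) (b0 : 0 < b).
Implicit Types (u v : R * R -> R).
Local Notation D := (rectangle a b).
Local Notation H1sq := (H1sq a b).
Local Notation dirichlet := (dirichlet a b).
Local Notation sq f := (\int[area]_(z in D) (f z ^+ 2)).
#[local] Hint Resolve measurable_rectangle : core.

Variables (CC : set (set (R * R) * (R * R -> R))) (c0 : set (R * R) * (R * R -> R)).
Hypotheses (CCD : forall c, CC c -> c.1 `<=` D) (CCc0 : CC c0)
  (bottom : forall x, 0 <= x <= a -> c0.1 (x, 0)).

(** [CC] gathers pairs of a set and a prescribed value, which treats boundary, regions and lines
    alike. The pair [c0], whose set contains the bottom edge, feeds the Poincare inequality. *)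
Definition admissible u := H1 D u /\ forall c, CC c -> has_trace D u c.1 c.2.

(** All affine combinations are allowed, not only convex ones: the midpoint gives the Cauchy
    property, and 2 f - u gives the minimality of the limit. *)
Lemma admissible_affine u v (k l : R) : admissible u -> admissible v -> k + l = 1 ->
  admissible (fun z => k * u z + l * v z).
Proof.
move=> [Hu Tu] [Hv Tv] kl; split; first exact: H1_lin.
move=> c Cc; have := has_trace_lin a0 b0 k l Hu Hv (Tu _ Cc) (Tv _ Cc).
have -> // : (fun z => k * c.2 z + l * c.2 z) = c.2.
by apply/funext => z; rewrite -mulrDl kl mul1r.
Qed.

Lemma poincare_admissible u v : admissible u -> admissible v ->
  H1sq (fun z => 1 * u z + -1 * v z) <=
  (2 * b ^+ 2 + 1) * dirichlet (fun z => 1 * u z + -1 * v z).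
Proof.
move=> [Hu Tu] [Hv Tv]; rewrite mulrDl mul1r lerD2r.
apply: (@poincare R a b a0 b0 _ c0.1 (H1_lin 1 (-1) Hu Hv) bottom).
have := has_trace_lin a0 b0 1 (-1) Hu Hv (Tu _ CCc0) (Tv _ CCc0).
have -> // : (fun z => 1 * c0.2 z + -1 * c0.2 z) = (fun=> 0).
by apply/funext => z; ring.
Qed.

(** The parallelogram law: the energy of u - v is twice that of u plus twice that of v minus four
    times that of the midpoint, hence at most 4 (m + e) - 4 m. *)
Lemma dirichlet_sub_le u v (m e : R) : (forall w, admissible w -> m <= dirichlet w) ->
  admissible u -> admissible v -> dirichlet u <= m + e -> dirichlet v <= m + e ->
  dirichlet (fun z => 1 * u z + -1 * v z) <= 4 * e.
Proof.
move=> hm Vu Vv ue ve; have [[Hu _] [Hv _]] := (Vu, Vv).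
have kl : 2^-1 + 2^-1 = 1 :> R by rewrite -[X in X + X]div1r -splitr.
have := hm _ (admissible_affine Vu Vv kl).
rewrite (dirichlet_lin a0 b0 _ _ Hu Hv) (dirichlet_lin a0 b0 _ _ Hu Hv).
move: ue ve; move: (dirichlet u) (dirichlet v) (dirichlet_form a b u v) => x y t; lra.
Qed.

(** [Riesz_Fischer] controls [u] only relative to the terms of the sequence; adding back [f 0] shows
    that [u] itself is in L^2. *)
Lemma L2_limit (f : nat -> R * R -> R) (c : R) : 0 <= c -> (forall n, L2 D (f n)) ->
  (forall n k, (n <= k)%N -> sq (fun z => f k z - f n z) <= c / 8 ^+ n) ->
  exists u : R * R -> R, L2 D u /\ forall n, sq (fun z => u z - f n z) <= c / 8 ^+ n.
Proof.
move=> c00 Lf fc.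
have Lff k n : L2 D (fun z => f k z - f n z).
  have -> : (fun z => f k z - f n z) = (fun z => 1 * f k z + -1 * f n z).
    by apply/funext => z; ring.
  exact: L2_lin.
have [u [mu Hu]] := @Riesz_Fischer _ (plane R) R area D (measurable_rectangle a b) f c c00
  (fun k => L2_measurable (Lf k)) (fun k n => L2_integrable_sqr (Lff k n)) fc.
exists u; split; last by move=> n; have [] := Hu n.
have Lu0 : L2 D (fun z => u z - f 0%N z).
  split; last by have [] := Hu 0%N.
  by apply: measurable_funB => //; exact: (L2_measurable (Lf 0%N)).
have -> : u = (fun z => 1 * (u z - f 0%N z) + 1 * f 0%N z).
  by apply/funext => z; ring.
exact: L2_lin.
Qed.

(** The functions and each of their weak partials converge separately in L^2, and closedness of the
    weak derivative identifies the limits. The factor 3 counts one function and two partials. *)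
Lemma H1_limit (f : nat -> R * R -> R) (c : R) : 0 <= c -> (forall n, H1 D (f n)) ->
  (forall n k, (n <= k)%N -> H1sq (fun z => 1 * f k z + -1 * f n z) <= c / 8 ^+ n) ->
  exists u, H1 D u /\ forall n, H1sq (f n \- u) <= 3 * (c / 8 ^+ n).
Proof.
move=> c00 Hf fc.
have sqe (g h : R * R -> R) : sq (fun z => g z - h z) = sq (fun z => 1 * g z + -1 * h z).
  by apply: eq_Rintegral => z _; congr (_ ^+ 2); ring.
have [u [Lu uf]] : exists u : R * R -> R, L2 D u /\
    forall n, sq (fun z => u z - f n z) <= c / 8 ^+ n.
  apply: L2_limit => // [n|n k nk]; first exact: H1_L2.
  rewrite sqe; apply: le_trans (fc _ _ nk).
  by rewrite lerDl dirichlet_ge0.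
have wp_le g i : sq (wpartial D i g) <= H1sq g.
  rewrite (le_trans _ (_ : dirichlet g <= _))//.
    rewrite /dirichlet (bigD1 i)//= lerDl sumr_ge0// => j _; exact: sqr_integral_ge0.
  by rewrite lerDr sqr_integral_ge0.
have /choice[p Hp] : forall i, exists p : R * R -> R, L2 D p /\
    forall n, sq (fun z => p z - wpartial D i (f n) z) <= c / 8 ^+ n.
  move=> i; apply: L2_limit => // [n|n k nk]; first exact: wpartial_L2.
  rewrite sqe -(sq_wpartial_lin a0 b0)//.
  by apply: le_trans (fc _ _ nk); exact: wp_le.
have Hup i : weak_partial D i u (p i).
  have [Lp pf] := Hp i; apply: weak_partial_approx => // e e0.
  have /cvgr0Pnorm_le /(_ _ e0)[n _ Hn] := cvg_expr_inv c (ltr1n R 8).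
  have {}Hn := le_trans (ler_norm _) (Hn n (leqnn n)).
  exists (f n), (wpartial D i (f n)); split.
  - exact: H1_L2.
  - exact: wpartialP.
  - exact: le_trans (uf n) Hn.
  - exact: le_trans (pf n) Hn.
have Hu : H1 D u by split=> // i; exists (p i).
exists u; split=> // n.
rewrite (_ : 3 * (c / 8 ^+ n) = c / 8 ^+ n + (c / 8 ^+ n + c / 8 ^+ n)); last by ring.
have sC (g h : R * R -> R) : sq (fun z => g z - h z) = sq (fun z => h z - g z).
  by apply: eq_Rintegral => z _; ring.
apply: lerD; first by rewrite sC.
have H i : sq (wpartial D i (f n \- u)) <= c / 8 ^+ n.
  have -> : f n \- u = (fun z => 1 * f n z + -1 * u z) by apply/funext => z /=; ring.
  have W : weak_partial D i (fun z => 1 * f n z + -1 * u z)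
      (fun z => 1 * wpartial D i (f n) z + -1 * p i z).
    by apply: weak_partial_lin => //; [exact: H1_L2|exact: wpartialP].
  rewrite (sq_wpartial a0 b0 W) -sqe sC; have [_] := Hp i; exact.
have -> : c / 8 ^+ n + c / 8 ^+ n = \sum_(i < 2) c / 8 ^+ n.
  by rewrite sumr_const card_ord mulr2n.
by apply: ler_sum => i _; exact: H.
Qed.

Lemma exists_minimizer : admissible !=set0 ->
  exists u, admissible u /\ forall v, admissible v -> dirichlet u <= dirichlet v.
Proof.
move=> [w0 Vw0].
pose E := [set dirichlet u | u in admissible].
have Einf : has_inf E.
  split; first by exists (dirichlet w0), w0.
  by exists 0 => _ [u _ <-]; exact: dirichlet_ge0.
pose m := inf E.
have hm v : admissible v -> m <= dirichlet v.
  by move=> Vv; apply: ge_inf; [exact: Einf.2|exists v].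
have d0 n : 0 < 1 / 8 ^+ n :> R by rewrite divr_gt0// exprn_gt0.
(* An excess of 8^-n gives at once the rate asked for by [H1_limit], without extracting a
   subsequence. *)
have /choice[f Hf] : forall n, exists u, admissible u /\ dirichlet u <= m + 1 / 8 ^+ n.
  move=> n; have [_ [u Vu <-] um] := inf_adherent (d0 n) Einf.
  by exists u; split => //; exact: ltW.
have Vf n : admissible (f n) by have [] := Hf n.
have Hfn n : H1 D (f n) by have [] := Vf n.
(* The Poincare constant for the H^1 norm times the 4 of [dirichlet_sub_le]. *)
pose c := (2 * b ^+ 2 + 1) * 4.
have c00 : 0 <= c by rewrite mulr_ge0// addr_ge0// mulr_ge0// sqr_ge0.
have fc n k : (n <= k)%N -> H1sq (fun z => 1 * f k z + -1 * f n z) <= c / 8 ^+ n.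
  move=> nk; apply: le_trans (poincare_admissible (Vf k) (Vf n)) _.
  rewrite /c -mulrA -[8 ^- n]div1r; apply: ler_wpM2l.
    by rewrite addr_ge0// mulr_ge0// sqr_ge0.
  have kn : dirichlet (f k) <= m + 1 / 8 ^+ n.
    have [_ /le_trans] := Hf k; apply; rewrite lerD2l !div1r lef_pV2 ?posrE ?exprn_gt0//.
    by rewrite ler_eXn2l// ltr1n.
  have [_ nn] := Hf n.
  exact: (dirichlet_sub_le hm (Vf k) (Vf n) kn nn).
have [u [Hu fu]] := H1_limit c00 Hfn fc.
have fu0 e : 0 < e -> exists n, 3 * (c / 8 ^+ n) <= e /\ 1 / 8 ^+ n <= e.
  move=> e0; have /cvgr0Pnorm_le /(_ _ e0)[n _ Hn] := cvg_expr_inv (3 * c + 1) (ltr1n R 8).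
  have {}Hn := le_trans (ler_norm _) (Hn n (leqnn n)).
  exists n; split; apply: le_trans Hn.
    by rewrite mulrA ler_pM2r ?invr_gt0 ?exprn_gt0// lerDl.
  by rewrite ler_pM2r ?invr_gt0 ?exprn_gt0// lerDr mulr_ge0.
have Vu : admissible u.
  split=> // -[S h] Cc; apply: (approx_has_trace Hu); apply: (trace_approx_closed a0 b0 Hu).
  move=> e e0; have [n [ne _]] := fu0 e e0; exists (f n).
  have [_ /(_ _ Cc) Tn] := Vf n; have SD := CCD Cc.
  split; [exact: Hfn|exact: has_trace_approx|exact: le_trans (fu n) ne].
exists u; split; first exact: Vu.
move=> v Vv; apply: le_trans (hm _ Vv).
apply/ler_addgt0Pr => e e0; have e4 : 0 < e / 4 by rewrite divr_gt0.
have [n [ne1 ne2]] := fu0 _ e4.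
(* With E the Dirichlet integral, the parallelogram law for f n and f n - u reads E(u) = 2 E(f n) +
   2 E(f n - u) - E(2 f n - u). Since 2 f n - u is admissible, the last term is at least m, so E(u)
   is bounded by m + e. *)
have kl : 2 + -1 = 1 :> R by ring.
have mP := hm _ (admissible_affine (Vf n) Vu kl).
have [_ fm] := Hf n.
have fuE : f n \- u = (fun z => 1 * f n z + -1 * u z) by apply/funext => z /=; ring.
have fu4 : dirichlet (f n \- u) <= e / 4.
  by apply: le_trans ne1; apply: le_trans (fu n); rewrite lerDr sqr_integral_ge0.
rewrite fuE (dirichlet_lin a0 b0 _ _ (Hfn n) Hu) in fu4.
rewrite (dirichlet_lin a0 b0 _ _ (Hfn n) Hu) in mP.
exact: parallelogram_bound mP fu4 fm ne2.
Qed.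

Lemma minimizer_ae_unique u v : admissible u -> admissible v ->
  (forall w, admissible w -> dirichlet u <= dirichlet w) -> dirichlet v <= dirichlet u ->
  {ae area, forall z, D z -> v z = u z}.
Proof.
move=> Vu Vv hu vu; have [[Hu _] [Hv _]] := (Vu, Vv).
have K0 : 0 <= 2 * b ^+ 2 + 1 by rewrite addr_ge0// mulr_ge0// sqr_ge0.
have := poincare_admissible Vv Vu.
(* The estimate is used with [dirichlet u] as the lower bound and zero excess. *)
have G0 : dirichlet (fun z => 1 * v z + -1 * u z) <= 4 * 0.
  have le0 (x y : R) : x <= y -> x <= y + 0 by rewrite addr0.
  have u0 := le0 _ _ (lexx (dirichlet u)).
  have v0 := le0 _ _ vu.
  exact: (dirichlet_sub_le hu Vv Vu v0 u0).
move=> /le_trans /(_ (ler_wpM2l K0 G0)); rewrite !mulr0 => sq0.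
have Ld := L2_lin (measurable_rectangle a b) 1 (-1) (H1_L2 Hv) (H1_L2 Hu).
have {}sq0 : sq (fun z => 1 * v z + -1 * u z) = 0.
  apply/eqP; rewrite eq_le sqr_integral_ge0 andbT; apply: le_trans sq0.
  by rewrite lerDl dirichlet_ge0.
have I := L2_integrable_sqr Ld.
have mI := measurable_int _ I.
have [+ _] := ae_eq_integral_abs area (measurable_rectangle a b) mI.
have -> : (\int[area]_(z in D) `|(EFin \o (fun z => (1 * v z + -1 * u z) ^+ 2)%R) z|)%E = 0%E.
  have /fineK <- := integrable_fin_num (measurable_rectangle a b) (integrable_abse I).
  congr EFin; rewrite -[RHS]sq0; congr fine; apply: eq_integral => z _ /=.
  by rewrite ger0_norm// sqr_ge0.
move=> /(_ erefl) A; apply: (negligibleS _ A) => z /= H uv; apply: H => Dz.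
have [/eqP] := uv Dz; rewrite sqrf_eq0 mul1r mulN1r subr_eq0 => /eqP.
exact.
Qed.

End ScalarProblem.

(** * From the scalar problem to planar maps *)

Lemma boundary_rectangle_sub {R : realType} (a b : R) :
  boundary (rectangle a b) `<=` rectangle a b.
Proof.
move=> z [+ _]; have /closure_id <- // : closed (rectangle a b).
apply: compact_closed; first exact: norm_hausdorff.
exact: compact_rect.
Qed.

Lemma boundary_rectangle_bottom {R : realType} (a b x : R) : 0 < b -> 0 <= x <= a ->
  boundary (rectangle a b) (x, 0).
Proof.
move=> b0 xa; split; last by rewrite interior_rectangle => -[/= _]; rewrite in_itv/= ltxx.
by apply: subset_closure; split; rewrite /= in_itv/= ?xa// lexx ltW.
Qed.

Lemma conformal_energyE {R : realType} (a b w : R) (f : R * R -> R * R) :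
  H1_vec (rectangle a b) f ->
  conformal_energy a b w f = 2^-1 * (dirichlet a b (Defs.coord ord0 \o f) +
    dirichlet a b (Defs.coord ord_max \o f)) - fine (area (rectangle (w * a) b)).
Proof.
move=> Hf; rewrite /conformal_energy; congr (_ * _ - _).
have mD := measurable_rectangle a b.
pose s i j (z : R * R) := wpartial (rectangle a b) j (Defs.coord i \o f) z ^+ 2.
have si i j : area.-integrable (rectangle a b) (EFin \o s i j).
  exact: (L2_integrable_sqr (wpartial_L2 j (Hf i))).
have sD i : area.-integrable (rectangle a b) (EFin \o (fun z => s i ord0 z + s i ord_max z)).
  exact: (integrableD mD (si i ord0) (si i ord_max)).
have dE i : dirichlet a b (Defs.coord i \o f) =
    \int[area]_(z in rectangle a b) (s i ord0 z + s i ord_max z).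
  rewrite /dirichlet sumr_I2.
  exact: esym (RintegralD mD (si i ord0) (si i ord_max)).
rewrite !dE -(RintegralD mD (sD ord0) (sD ord_max)).
apply: eq_Rintegral => z _; rewrite /frobenius sqr_sqrtr; last first.
  by apply: sumr_ge0 => i _; apply: sumr_ge0 => j _; exact: sqr_ge0.
have JE i j : Defs.jacobian (rectangle a b) f z i j ^+ 2 = s i j z by rewrite mxE.
rewrite (eq_bigr _ (fun i _ => eq_bigr _ (fun j _ => JE i j))).
rewrite sumr_I2; congr (_ + _); exact: sumr_I2.
Qed.

Lemma half_sum_le {R : realType} (x y s t m : R) : x <= s -> y <= t ->
  2^-1 * (x + y) - m <= 2^-1 * (s + t) - m.
Proof. by move=> *; lra. Qed.

(** For uniqueness: when each coordinate already has at least its minimal energy, a sum that is not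
    larger than the sum of the minima forces both coordinates to be minimal. *)
Lemma half_sum_ge {R : realType} (x y s t m : R) : x <= s -> y <= t ->
  2^-1 * (s + t) - m <= 2^-1 * (x + y) - m -> s <= x /\ t <= y.
Proof. by move=> *; split; lra. Qed.

(** An element of H^1 is a function up to null sets, whence the form of the uniqueness. [hfeasible]
    provides the competitor that makes the infimum meaningful. *)
Theorem theorem4 (R : realType) (a b w : R) (K J : nat)
    (O : 'I_K -> set (R * R)) (L : 'I_J -> set (R * R))
    (rO : R) (tO : 'I_K -> R * R)
    (RL : 'I_J -> 'M[R]_2) (tL : 'I_J -> R * R) (g : R * R -> R * R)
    (ha : 0 < a) (hb : 0 < b) (hw : 0 < w)
    (hO : forall i, O i `<=` rectangle a b)
    (hL : forall j, L j `<=` rectangle a b)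
    (hOO : forall i i', i != i' -> O i `&` O i' = set0)
    (hLL : forall j j', j != j' -> L j `&` L j' = set0)
    (hOL : forall i j, O i `&` L j = set0)
    (hOD : forall i, O i `&` boundary (rectangle a b) = set0)
    (hLD : forall j, L j `&` boundary (rectangle a b) = set0)
    (hrO : 0 < rO)
    (hRL : forall j, is_diag_mx (RL j) /\ forall k, 0 < RL j k k)
    (htO : forall i x, O i x -> rectangle (w * a) b (rO *: x + tO i))
    (htL : forall j x, L j x -> rectangle (w * a) b (apply_mx (RL j) x + tL j))
    (hg_bij : set_bij (boundary (rectangle a b))
                      (boundary (rectangle (w * a) b)) g)
    (hg_cont : {within boundary (rectangle a b), continuous g})
    (hg00 : g (pt 0 0) = pt 0 0) (hga0 : g (pt a 0) = pt (w * a) 0)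
    (hg0b : g (pt 0 b) = pt 0 b) (hgab : g (pt a b) = pt (w * a) b)
    (hbounded : bounded_set
       (rectangle a b `\` (\bigcup_i O i `|` \bigcup_j L j))°)
    (hLipschitz : lipschitz_boundary
       (rectangle a b `\` (\bigcup_i O i `|` \bigcup_j L j))°)
    (hfeasible : feasible a b O L rO tO RL tL g !=set0) :
  exists f : R * R -> R * R,
    minimizer (feasible a b O L rO tO RL tL g) (conformal_energy a b w) f /\
    forall f' : R * R -> R * R,
      minimizer (feasible a b O L rO tO RL tL g) (conformal_energy a b w) f' ->
      {ae area, forall z, rectangle a b z -> f' z = f z}.
Proof.
pose D := rectangle a b.
pose bc (i : 'I_2) : set (R * R) * (R * R -> R) := (boundary D, Defs.coord i \o g).
(* Every condition on the map is read on its [i]-th coordinate; the boundary condition [bc i] is the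
   one that contains the bottom edge. *)
pose CC (i : 'I_2) : set (set (R * R) * (R * R -> R)) := [set c |
  [\/ c = bc i, exists k, c = (O k, Defs.coord i \o (fun x => rO *: x + tO k)) |
      exists j, c = (L j, Defs.coord i \o (fun x => apply_mx (RL j) x + tL j))]].
have CCD i c : CC i c -> c.1 `<=` D.
  case=> [->|[k ->]|[j ->]]; [exact: boundary_rectangle_sub|exact: hO|exact: hL].
have CCb i : CC i (bc i) by constructor 1.
have bottom i x : 0 <= x <= a -> (bc i).1 (x, 0) by exact: boundary_rectangle_bottom.
have feasibleP f : feasible a b O L rO tO RL tL g f <->
    forall i, admissible a b (CC i) (Defs.coord i \o f).
  split=> [[Hf Tb TO TL] i|A].
    split; first exact: Hf.
    by move=> c [->|[k ->]|[j ->]]; [exact: Tb|exact: TO|exact: TL].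
  split=> [i|i|k i|j i]; have [H T] := A i; first exact: H.
  - exact: (T _ (CCb i)).
  - by have := T (O k, Defs.coord i \o (fun x => rO *: x + tO k)); apply; constructor 2; exists k.
  - by have := T (L j, Defs.coord i \o (fun x => apply_mx (RL j) x + tL j)); apply;
      constructor 3; exists j.
have [f0 /feasibleP A0] := hfeasible.
have /choice[U HU] : forall i, exists u, admissible a b (CC i) u /\
    forall v, admissible a b (CC i) v -> dirichlet a b u <= dirichlet a b v.
  move=> i; apply: (exists_minimizer ha hb (@CCD i) (CCb i) (bottom i)).
  by exists (Defs.coord i \o f0).
pose f z := pt (U ord0 z) (U ord_max z).
have fU i : Defs.coord i \o f = U i by apply/funext => z; have [->|->] := I2_cases i.
have Ff : feasible a b O L rO tO RL tL g f.
  by apply/feasibleP => i; rewrite fU; exact: (HU i).1.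
have EE h : feasible a b O L rO tO RL tL g h -> conformal_energy a b w h =
    2^-1 * (dirichlet a b (Defs.coord ord0 \o h) +
    dirichlet a b (Defs.coord ord_max \o h)) - fine (area (rectangle (w * a) b)).
  by case=> Hh *; exact: conformal_energyE.
have Ule h i : feasible a b O L rO tO RL tL g h ->
    dirichlet a b (U i) <= dirichlet a b (Defs.coord i \o h).
  by move=> /feasibleP/(_ i); exact: (HU i).2.
exists f; split.
  split; first exact: Ff.
  move=> h Fh; rewrite (EE _ Ff) (EE _ Fh) !fU.
  exact: (half_sum_le _ (Ule h ord0 Fh) (Ule h ord_max Fh)).
move=> h [Fh hmin]; have := hmin _ Ff; rewrite (EE _ Ff) (EE _ Fh) !fU.
move=> /(half_sum_ge (Ule h ord0 Fh) (Ule h ord_max Fh))[h0 h1].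
have hU i : dirichlet a b (Defs.coord i \o h) <= dirichlet a b (U i).
  by have [->|->] := I2_cases i.
have hae i := minimizer_ae_unique ha hb (CCb i) (bottom i) (HU i).1
  (iffLR (feasibleP h) Fh i) (HU i).2 (hU i).
apply: (negligibleS _ (negligibleU (hae ord0) (hae ord_max))) => z /= nz.
apply: contrapT => /not_orP[/contrapT z0 /contrapT z1]; apply: nz => Dz.
by move: (z0 Dz) (z1 Dz); rewrite /f /Defs.coord/=; case: (h z) => x y /= -> ->.
Qed.
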